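(* Let $D\subset\mathbb{C}$ be open and symmetric with respect to the real axis, and let $f$ be a slice regular function on $\Omega_D\subset\mathbb{R}^{m+1}$, $f(x_0+\underline x)=\alpha(x_0,r)+\underline\omega\,\beta(x_0,r)$ with $r=|\underline x|$. Write $\underline\omega=\underline x/|\underline x|=\sum_{j=1}^m e_j\omega_j$ with $\omega_j\in\mathbb{R}$. Then $\alpha(x_0,r)$ and $\omega_j\beta(x_0,r)$, $1\le j\le m-1$, are hyperbolic harmonic, i.e. on $\Omega_D\setminus\mathbb{R}$ $$\left(x_m^2\Delta_{\mathbb{R}^{m+1}}-(m-1)x_m\partial_{x_m}\right)\alpha(x_0,r)=0,$$ $$\left(x_m^2\Delta_{\mathbb{R}^{m+1}}-(m-1)x_m\partial_{x_m}\right)\omega_j\beta(x_0,r)=0,\qquad 1\le j\le m-1,$$ while $\omega_m\beta(x_0,r)$ is an eigenfunction of the hyperbolic Laplace operator corresponding to the eigenvalue $1-m$, i.e. $$\left(x_m^2\Delta_{\mathbb{R}^{m+1}}-(m-1)x_m\partial_{x_m}\right)\omega_m\beta(x_0,r)=(1-m)\,\omega_m\beta(x_0,r).$$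
   Context: $\mathbb{R}_{0,m}$ is the real universal Clifford algebra generated by $e_1,\dots,e_m$ with $e_je_k=-e_ke_j$ ($j\ne k$), $e_j^2=-1$. Vectors in $\mathbb{R}^m$ are identified with $\underline{x}=\sum_{j=1}^m x_je_j$ and $\mathbb{R}^{m+1}$ with the paravectors $x_0+\underline{x}$. $\mathbb{S}^{m-1}$ is the unit sphere of $\mathbb{R}^m$. $\Delta_{\mathbb{R}^{m+1}}=\sum_{j=0}^m\partial_{x_j}^2$, acting componentwise on $\mathbb{R}_{0,m}$-valued functions. $\Omega_D=\{a+\underline\omega b: a+ib\in D,\ \underline\omega\in\mathbb{S}^{m-1}\}$. A stem function is $F=\alpha+i\beta:D\to\mathbb{R}_{0,m}\otimes\mathbb{C}$ with $\alpha,\beta$ $\mathbb{R}_{0,m}$-valued, $\alpha(\bar z)=\alpha(z)$, $\beta(\bar z)=-\beta(z)$. A function $f:\Omega_D\to\mathbb{R}_{0,m}$ is slice regular if $f(x_0+\underline x)=\alpha(x_0,|\underline x|)+\underline\omega\,\beta(x_0,|\underline x|)$ for a stem function $F=\alpha+i\beta$ that is holomorphic, i.e. $\partial_s\alpha=\partial_t\beta$, $\partial_t\alpha=-\partial_s\beta$ in $z=s+it$. *)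

(* Defs.v *)
From HB Require Import structures.
From mathcomp Require Import all_boot all_order all_algebra.
From mathcomp Require Export complex.
From mathcomp Require Import all_classical all_reals all_analysis.

Set Implicit Arguments.
Unset Strict Implicit.
Unset Printing Implicit Defensive.

Import Order.TTheory GRing.Theory Num.Theory.
Import numFieldNormedType.Exports.

Local Open Scope ring_scope.
Local Open Scope classical_set_scope.
Local Open Scope complex_scope.

(* An element of the Clifford algebra R_{0,m} is the family of its
   coefficients on the basis e_A = e_{a_1} ... e_{a_k}, where
   A = {a_1 < ... < a_k} is a subset of 'I_m; the generators are numbered from
   0 here.  The alias hides the pointwise ring structure of finite functions:
   only the vector space structure is inherited from it. *)
Definition clifford (R : realType) (m : nat) : Type := {ffun {set 'I_m} -> R}.

HB.instance Definition _ (R : realType) (m : nat) :=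
  GRing.Lmodule.copy (clifford R m) {ffun {set 'I_m} -> R^o}.

Section CliffordAlgebra.
Variables (R : realType) (m : nat).
Implicit Types (A B C : {set 'I_m}) (x y z : clifford R m).

Definition coef A x : R := (x : {ffun {set 'I_m} -> R}) A.

Definition blade A : clifford R m := [ffun B => (B == A)%:R].

(* e_A e_B = csign A B *: e_(A symmdiff B): moving e_j to the left past every
   e_i with i > j gives one sign each, and e_j e_j = -1 gives one more. *)
Definition csign A B : R :=
  \prod_(i in A) \prod_(j in B | (j <= i)%N) (-1).

Definition symmd A B : {set 'I_m} := (A :\: B) :|: (B :\: A).

Definition clifford_one : clifford R m := blade finset.set0.

Definition clifford_mul x y : clifford R m :=
  [ffun C => \sum_A csign A (symmd A C) * coef A x * coef (symmd A C) y].

Lemma coefP x y : (forall A, coef A x = coef A y) -> x = y.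
Proof. by move=> h; apply/ffunP. Qed.

Lemma coefD A x y : coef A (x + y) = coef A x + coef A y.
Proof. by rewrite /coef ffunE. Qed.

Lemma coefN A x : coef A (- x) = - coef A x.
Proof. by rewrite /coef ffunE. Qed.

Lemma coef0 A : coef A 0 = 0.
Proof. by rewrite /coef ffunE. Qed.

Lemma coefZ A (a : R) x : coef A (a *: x) = a * coef A x.
Proof. by rewrite /coef ffunE. Qed.

Lemma coef_blade A B : coef B (blade A) = (B == A)%:R.
Proof. by rewrite /coef ffunE. Qed.

Lemma coef_mul C x y : coef C (clifford_mul x y) =
  \sum_A csign A (symmd A C) * coef A x * coef (symmd A C) y.
Proof. by rewrite /coef ffunE. Qed.

Lemma in_symmd i A B : (i \in symmd A B) = (i \in A) (+) (i \in B).
Proof. by rewrite !inE; case: (i \in A); case: (i \in B). Qed.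

Lemma symmdA A B C : symmd A (symmd B C) = symmd (symmd A B) C.
Proof. by apply/setP=> i; rewrite !in_symmd addbA. Qed.

Lemma symmdC A B : symmd A B = symmd B A.
Proof. by apply/setP=> i; rewrite !in_symmd addbC. Qed.

Lemma symmd0 A : symmd A finset.set0 = A.
Proof. by apply/setP=> i; rewrite in_symmd inE addbF. Qed.

Lemma symmdd A : symmd A A = finset.set0.
Proof. by apply/setP=> i; rewrite in_symmd inE addbb. Qed.

Lemma symmdK A B : symmd A (symmd A B) = B.
Proof. by rewrite symmdA symmdd symmdC symmd0. Qed.

Lemma csignE A B : csign A B =
  \prod_(i < m) \prod_(j < m | (j <= i)%N) (-1) ^+ ((i \in A) && (j \in B)).
Proof.
rewrite /csign big_mkcond; apply: eq_bigr => i _.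
case: ifP => iA /=; last by rewrite big1.
rewrite [LHS]big_mkcond [RHS]big_mkcond; apply: eq_bigr => j _.
by case: (j \in B); case: ifP.
Qed.

Lemma csignDl A B C : csign (symmd A B) C = csign A C * csign B C.
Proof.
rewrite !csignE -big_split; apply: eq_bigr => i _.
rewrite -big_split; apply: eq_bigr => j _ /=.
by rewrite in_symmd andb_addl signr_addb.
Qed.

Lemma csignDr A B C : csign A (symmd B C) = csign A B * csign A C.
Proof.
rewrite !csignE -big_split; apply: eq_bigr => i _.
rewrite -big_split; apply: eq_bigr => j _ /=.
by rewrite in_symmd andb_addr signr_addb.
Qed.

Lemma csign0l A : csign finset.set0 A = 1.
Proof. by rewrite /csign big_set0. Qed.

Lemma csign0r A : csign A finset.set0 = 1.
Proof. by rewrite /csign big1 // => i _; rewrite big1 // => j; rewrite inE. Qed.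

Lemma blade_mul A B :
  clifford_mul (blade A) (blade B) = csign A B *: blade (symmd A B).
Proof.
apply: coefP => C; rewrite coef_mul coefZ coef_blade (bigD1 A) //= big1.
  rewrite addr0 !coef_blade eqxx mulr1.
  have -> : (C == symmd A B) = (symmd A C == B).
    by apply/eqP/eqP => [->|<-]; rewrite symmdK.
  by case: eqP => [->|]; rewrite ?mulr0.
by move=> D /negPf nDA; rewrite coef_blade nDA mulr0 mul0r.
Qed.

Fact clifford_mulA : associative clifford_mul.
Proof.
move=> x y z; apply: coefP => D; rewrite !coef_mul.
transitivity (\sum_A \sum_B csign A (symmd A D) * csign B (symmd B (symmd A D))
   * (coef A x * coef B y * coef (symmd B (symmd A D)) z)).
  apply: eq_bigr => A _; rewrite coef_mul mulr_sumr; apply: eq_bigr => B _.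
  by rewrite !mulrA; congr (_ * _ * _); rewrite mulrAC.
transitivity (\sum_C \sum_A csign C (symmd C D) * csign A (symmd A C)
   * (coef A x * coef (symmd A C) y * coef (symmd C D) z)); last first.
  apply: eq_bigr => C _; rewrite coef_mul mulr_sumr mulr_suml.
  by apply: eq_bigr => A _; rewrite !mulrA.
rewrite [RHS]exchange_big /=; apply: eq_bigr => A _.
rewrite (reindex_inj (h := symmd A)) /=; last exact: can_inj (symmdK A).
apply: eq_bigr => C _.
have -> : symmd (symmd A C) (symmd A D) = symmd C D.
  by rewrite (symmdC A C) -symmdA symmdK.
congr (_ * _).
have -> : symmd A D = symmd (symmd A C) (symmd C D).
  by rewrite -symmdA symmdK.
rewrite csignDr csignDl -[LHS]mulrA (mulrA (csign A (symmd C D))) -csignDl.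
by rewrite symmdd csign0l mul1r mulrC.
Qed.

Fact clifford_mul1x : left_id clifford_one clifford_mul.
Proof.
move=> x; apply: coefP => C; rewrite coef_mul (bigD1 finset.set0) //= big1.
  by rewrite addr0 coef_blade eqxx symmdC symmd0 csign0l !mul1r.
by move=> A /negPf nA; rewrite coef_blade nA mulr0 mul0r.
Qed.

Fact clifford_mulx1 : right_id clifford_one clifford_mul.
Proof.
move=> x; apply: coefP => C; rewrite coef_mul (bigD1 C) //= big1.
  by rewrite addr0 coef_blade symmdd eqxx csign0r mul1r mulr1.
move=> A nAC; rewrite coef_blade; case: eqP => [e|]; last by rewrite mulr0.
by rewrite -(symmdK A C) e symmd0 eqxx in nAC.
Qed.

Fact clifford_mulDl : left_distributive clifford_mul +%R.
Proof.
move=> x y z; apply: coefP => C; rewrite coefD !coef_mul -big_split.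
by apply: eq_bigr => A _; rewrite coefD mulrDr mulrDl.
Qed.

Fact clifford_mulDr : right_distributive clifford_mul +%R.
Proof.
move=> x y z; apply: coefP => C; rewrite coefD !coef_mul -big_split.
by apply: eq_bigr => A _; rewrite coefD mulrDr.
Qed.

Fact clifford_oner_neq0 : clifford_one != 0.
Proof.
apply/eqP => /(congr1 (coef finset.set0)); rewrite coef_blade coef0 eqxx.
by move/eqP; rewrite oner_eq0.
Qed.

HB.instance Definition _ := GRing.Zmodule_isNzRing.Build (clifford R m)
  clifford_mulA clifford_mul1x clifford_mulx1 clifford_mulDl clifford_mulDr
  clifford_oner_neq0.

Fact clifford_scaleAl (a : R) x y : a *: (x * y) = (a *: x) * y.
Proof.
apply: coefP => C; rewrite coefZ !coef_mul mulr_sumr.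
by apply: eq_bigr => A _; rewrite coefZ !mulrA (mulrC a).
Qed.

HB.instance Definition _ :=
  GRing.Lmodule_isLalgebra.Build R (clifford R m) clifford_scaleAl.

Fact clifford_scaleAr (a : R) x y : a *: (x * y) = x * (a *: y).
Proof.
apply: coefP => C; rewrite coefZ !coef_mul mulr_sumr.
by apply: eq_bigr => A _; rewrite coefZ mulrCA.
Qed.

HB.instance Definition _ :=
  GRing.Lalgebra_isAlgebra.Build R (clifford R m) clifford_scaleAr.

Definition gen (j : 'I_m) : clifford R m := blade [set j]%SET.

Lemma gen_sqr (j : 'I_m) : gen j * gen j = -1.
Proof.
rewrite [LHS]blade_mul symmdd /csign big_set1 big_mkcondr big_set1 leqnn.
by rewrite scaleN1r.
Qed.

Lemma gen_anticomm (j k : 'I_m) : j != k -> gen j * gen k = - (gen k * gen j).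
Proof.
move=> njk; rewrite [LHS]blade_mul [X in - X]blade_mul symmdC /csign.
rewrite !big_set1 ![\prod_(_ in _ | _) _]big_mkcondr !big_set1 -scaleNr.
congr (_ *: _); case: ltngtP => [_|_|/val_inj e]; rewrite ?opprK //.
by rewrite e eqxx in njk.
Qed.

Lemma clifford_blade x : x = \sum_A coef A x *: blade A.
Proof.
apply: coefP => B; rewrite (bigD1 B) //= coefD coefZ coef_blade eqxx mulr1.
rewrite -[LHS]addr0; congr (_ + _); apply/esym.
by elim/big_rec: _ => [|A y nA y0]; rewrite ?coef0 // coefD y0 addr0 coefZ
  coef_blade eq_sym (negPf nA) mulr0.
Qed.

Lemma gen_blade (i : 'I_m) A : (forall j, j \in A -> (i < j)%N) ->
  gen i * blade A = blade (i |: A).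
Proof.
move=> iA; rewrite [LHS]blade_mul /csign big_set1 big1 ?scale1r.
  congr blade; apply/setP => k; rewrite in_symmd !inE.
  by case: eqP => [->|//]; case: (boolP (i \in A)) => // /iA; rewrite ltnn.
by move=> j /andP[/iA ij]; rewrite leqNgt ij.
Qed.

End CliffordAlgebra.

Section Paravectors.
Variables (R : realType) (m : nat).
(* The coordinates (x_0, x_1, ..., x_m) of a paravector; its vector part
   (x_1, ..., x_m) is [rsubmx x].  The library norm of a matrix is the sup
   norm, hence [vnorm]. *)
Implicit Types (x : 'rV[R]_(1 + m)) (v : 'rV[R]_m) (D : set R[i]).

Definition vnorm v : R := Num.sqrt (\sum_(j < m) v 0 j ^+ 2).

Definition clifford_vector v : clifford R m := \sum_(j < m) v 0 j *: gen R j.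

Definition paravector (a : R) v : 'rV[R]_(1 + m) := row_mx a%:M v.

Definition axially_symmetric_completion D : set 'rV[R]_(1 + m) :=
  [set x | exists a b w,
     [/\ D (a +i* b), vnorm w = 1 & x = paravector a (b *: w)]].

Definition real_axis : set 'rV[R]_(1 + m) := [set x | rsubmx x = 0].

(* x_0 + i |x|, where |x| is the norm of the vector part *)
Definition slice_point x : R[i] := x 0 ord0 +i* vnorm (rsubmx x).

(* omega_j = x_j / |x| for 1 <= j <= m *)
Definition omega_coord (j : 'I_(1 + m)) x : R := x 0 j / vnorm (rsubmx x).

(* On the real axis this is 0, a harmless choice since the component beta of a
   stem function vanishes at real points. *)
Definition omega x : clifford R m :=
  clifford_vector ((vnorm (rsubmx x))^-1 *: rsubmx x).

End Paravectors.

Section SliceRegular.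
Variables (R : realType) (m : nat).
Implicit Types (D : set R[i]) (alpha beta : R[i] -> clifford R m).

Definition conj_symmetric D := forall z, D z -> D z^*.

(* F = alpha + i beta : D -> R_{0,m} (x) C *)
Definition stem_function D alpha beta :=
  forall z, D z -> alpha z^* = alpha z /\ beta z^* = - beta z.

Definition plane_coef alpha A (p : R * R) : R := coef A (alpha (p.1 +i* p.2)).

Definition holomorphic D alpha beta :=
  forall s t, D (s +i* t) -> forall A,
    let a := plane_coef alpha A in
    let b := plane_coef beta A in
    [/\ differentiable a (s, t), differentiable b (s, t),
        'D_(1, 0) a (s, t) = 'D_(0, 1) b (s, t)
      & 'D_(0, 1) a (s, t) = - 'D_(1, 0) b (s, t)].

Definition induces D alpha beta (f : 'rV[R]_(1 + m) -> clifford R m) :=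
  forall x, axially_symmetric_completion D x ->
    f x = alpha (slice_point x) + omega x * beta (slice_point x).

Definition slice_regular D f := exists alpha beta,
  [/\ stem_function D alpha beta, holomorphic D alpha beta
    & induces D alpha beta f].

End SliceRegular.

Section HyperbolicLaplacian.
Variables (R : realType) (m : nat).
Implicit Types (u : 'rV[R]_(1 + m) -> clifford R m) (g : 'rV[R]_(1 + m) -> R).

Definition partial (j : 'I_(1 + m)) g : 'rV[R]_(1 + m) -> R :=
  'D_(delta_mx 0 j) g.

Definition laplacian g (x : 'rV[R]_(1 + m)) : R := \sum_(j < 1 + m) partial j (partial j g) x.

Definition hyperbolic_laplacian u (x : 'rV[R]_(1 + m)) : clifford R m :=
  [ffun A => let g y := coef A (u y) in
     x 0 ord_max ^+ 2 * laplacian g x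
     - (m%:R - 1) * x 0 ord_max * partial ord_max g x].

(* ['D_v g x] has a junk value when the derivative does not exist, so the
   derivatives occurring in the operator are required to exist. *)
Definition has_second_partials u (x : 'rV[R]_(1 + m)) := forall A j,
  let g y := coef A (u y) in
  derivable g x (delta_mx 0 j) /\ derivable (partial j g) x (delta_mx 0 j).

Definition hyperbolic_eigenfunction (U : set 'rV[R]_(1 + m)) (lambda : R) u :=
  forall x, U x ->
    has_second_partials u x /\ hyperbolic_laplacian u x = lambda *: u x.

Definition hyperbolic_harmonic (U : set 'rV[R]_(1 + m)) u :=
  forall x, U x -> has_second_partials u x /\ hyperbolic_laplacian u x = 0.

End HyperbolicLaplacian.

(* Main.v *)
Require Import Defs.
From mathcomp Require Import all_boot all_order all_algebra.
From mathcomp Require Import complex ring lra.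
From mathcomp Require Import all_classical all_reals all_analysis.

Set Implicit Arguments.
Unset Strict Implicit.
Unset Printing Implicit Defensive.

Import Order.TTheory GRing.Theory Num.Theory.
Import numFieldNormedType.Exports.

Local Open Scope ring_scope.
Local Open Scope classical_set_scope.

(** The two components alpha, beta of a slice regular function are determined by
the function: replacing the unit vector omega by - omega exchanges
alpha + omega beta and alpha - omega beta, and omega ^ 2 = -1 makes omega
cancellable.  So the given pair coincides, on the points x_0 + i |x| with
|x| > 0, with a pair satisfying the Cauchy-Riemann equations
([stem_unique]).

Granted that each real component u of alpha or beta has second pure partial
derivatives with u_ss + u_tt = 0, the theorem is a computation in the chain
rule: alpha(x_0, |x|) and x_j * (beta(x_0, |x|) / |x|) are both of the form
kappa(x) * B(x_0, |x|) with kappa affine along the coordinate lines, and the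
Laplacian of such a product is given by [profile_laplacian].

The substance is therefore the regularity of the components: holomorphy says
that they are differentiable and satisfy the Cauchy-Riemann equations, and the
second derivatives have to be constructed.  This is done in real terms, with
integrals of functions of one variable only.

- Goursat.  If P and Q are differentiable and P_t = Q_s, then P ds + Q dt has a
  primitive p on a square ([closed_form_primitive]).  The boundary integral over
  a rectangle is additive, and small compared with the squared size of the
  rectangle near each point; bisection shows that it vanishes
  ([rectangle_form_eq0]).  For (P, Q) = (a, - b) the primitive p has the second
  partial derivatives p_ss = a_s and p_tt = - b_t = - a_s, hence is harmonic
  in the elementary sense of [harmonic_on].
- The weak maximum principle for such functions needs only the second
  derivative test ([maximum_principle]).  Comparing the odd part of u in s with
  an explicit harmonic quadratic polynomial bounds u_s at the centre of a
  square by the supremum of |u| ([harmonic_gradient]); applying this twice,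
  through difference quotients, bounds u_ss ([harmonic_second]).
- The difference quotients p_h of p in the direction s are harmonic and converge
  to p_s = a at a rate linear in h, since p_ss is bounded.  By the second
  derivative bound the (p_h)_ss = - (p_h)_tt also form a Cauchy family, and
  their limit is both a_ss and - a_tt ([primitive_smooth]).  The same argument
  with (b, - a) in place of (a, b) treats the other component
  ([holomorphic_smooth]). *)

(** * Derivatives of functions of one real variable *)

Lemma is_deriveP (R : realType) (f : R -> R) (x l : R) :
  is_derive x 1 f l <->
  forall e, 0 < e -> exists2 d, 0 < d &
    forall h, `|h| < d -> `|f (x + h) - f x - l * h| <= e * `|h|.
Proof.
split=> [[df <-] e e0|fl].
  have /derivable_nbhsP/eqaddoP/(_ e e0) := df.
  rewrite -nbhs_nearE => /nbhs_ballP[d /= d0 dP].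
  exists d => // h hd; have /= := dP h.
  rewrite /ball /= sub0r normrN => /(_ hd).
  rewrite !fctE /= [_%:A]mulr1 opprD addrA (addrC h x).
  by rewrite [h *: _]mulrC.
have cvl : (fun h => h^-1 *: ((f \o shift x) (h *: (1 : R)) - f x)) @ 0^' --> l.
  apply/cvgrPdist_le => /= e e0; have [d d0 dP] := fl e e0.
  apply/nbhs_ballP; exists d => //= h.
  rewrite /ball /= sub0r normrN => hd h0.
  have nh : 0 < `|h| by rewrite normr_gt0.
  rewrite distrC -(ler_pM2r nh) -normrM.
  have -> : (h^-1 *: (f (h *: (1 : R) + x) - f x) - l) * h =
      f (x + h) - f x - l * h.
    by rewrite /GRing.scale /= mulr1 (addrC h) mulrBl mulrAC mulVf // mul1r.
  exact: dP.
split; first by apply/cvg_ex; exists l.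
exact: (cvg_lim (@Rhausdorff R)) cvl.
Qed.

Section Between.
Variable R : realType.
Implicit Types (a b x : R).

(** Symmetric in a and b, so that increments of either sign are covered by one
statement of the mean value theorem. *)
Definition between a b x := (a <= x <= b) \/ (b <= x <= a).

Lemma between_ball a b x s r :
  between a b x -> `|a - s| < r -> `|b - s| < r -> `|x - s| < r.
Proof.
rewrite !ltr_norml => -[] /andP[? ?] /andP[? ?] /andP[? ?];
by apply/andP; split; lra.
Qed.

Lemma between_sub a b x y : between a b x -> between a x y -> between a b y.
Proof.
by rewrite /between => -[] /andP[? ?] [] /andP[? ?];
  [left|left|right|right]; apply/andP; split; lra.
Qed.

Lemma between_dist a b x : between a b x -> `|x - a| <= `|b - a|.
Proof.
case=> /andP[h1 h2].
  rewrite ger0_norm ?subr_ge0 // ger0_norm ?subr_ge0 ?lerB //.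
  exact: le_trans h2.
rewrite ler0_norm ?subr_le0 // ler0_norm ?subr_le0 ?lerN2 ?lerB //.
exact: le_trans h2.
Qed.

Lemma between_width a b s x :
  a <= s <= b -> between a b x -> `|x - s| <= b - a.
Proof.
by rewrite ler_norml => /andP[? ?] -[] /andP[? ?]; apply/andP; split; lra.
Qed.

Lemma is_derive_continuous (f : R -> R) (x l : R) :
  is_derive x 1 f l -> {for x, continuous f}.
Proof.
by case=> df _; apply: differentiable_continuous; exact/derivable1_diffP.
Qed.

Lemma MVT_between (f df : R -> R) a b :
  (forall x, between a b x -> is_derive x 1 f (df x)) ->
  exists2 c, between a b c & f b - f a = df c * (b - a).
Proof.
move=> fdf.
wlog ab : a b fdf / a <= b => [wl|].
  have [/wl|/ltW /wl] := leP a b; first exact.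
  have fdf' x : between b a x -> is_derive x 1 f (df x).
    by move=> xba; apply: fdf; case: xba; [right|left].
  case/(_ fdf') => c cba e; exists c; first by case: cba; [right|left].
  by rewrite -[LHS]opprB e -mulrN opprB.
have [||c cab e] := @MVT_segment R f df a b ab.
- by move=> x; rewrite in_itv /= => /andP[/ltW ? /ltW ?]; apply: fdf; left; apply/andP.
- apply: continuous_in_subspaceT => x; rewrite inE /= in_itv /= => xab.
  by apply: (@is_derive_continuous _ _ (df x)); apply: fdf; left.
by exists c => //; left; move: cab; rewrite in_itv.
Qed.

Lemma MVT_bound (f df : R -> R) a b K :
  (forall x, between a b x -> is_derive x 1 f (df x)) ->
  (forall x, between a b x -> `|df x| <= K) ->
  `|f b - f a| <= K * `|b - a|.
Proof.
move=> fdf dfK; have [c cab ->] := MVT_between fdf.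
by rewrite normrM ler_wpM2r // dfK.
Qed.

Lemma is_derive_translate (f : R -> R) (c x l : R) :
  is_derive (x + c) 1 f l -> is_derive x 1 (fun y => f (y + c)) l.
Proof.
move/is_deriveP => fl; apply/is_deriveP => e /fl[d d0 dP]; exists d => // h.
by rewrite (addrAC x); apply: dP.
Qed.

Lemma is_derive_reflect (f : R -> R) (c x l : R) :
  is_derive (c - x) 1 f l -> is_derive x 1 (fun y => f (c - y)) (- l).
Proof.
move/is_deriveP => fl; apply/is_deriveP => e /fl[d d0 dP]; exists d => // h hd.
by have := dP (- h); rewrite normrN => /(_ hd); rewrite mulrN mulNr opprD addrA.
Qed.

Lemma is_derive_near (f g : R -> R) (x l d : R) : 0 < d ->
  (forall y, `|y - x| < d -> f y = g y) -> is_derive x 1 f l ->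
  is_derive x 1 g l.
Proof.
move=> d0 fg /is_deriveP fl; apply/is_deriveP => e /fl[d1 d10 dP].
exists (Num.min d d1) => [|h]; first by rewrite lt_min d0.
rewrite lt_min => /andP[hd hd1]; rewrite -!fg ?subrr ?normr0 //; last first.
  by rewrite addrAC subrr add0r.
exact: dP.
Qed.

(** Increments to the right are those that the barrier of [harmonic_gradient] and
the difference quotients of [harmonic_second] control. *)
Lemma derive_bound (f : R -> R) (x l K d : R) : 0 < d ->
  is_derive x 1 f l ->
  (forall h, 0 < h < d -> `|f (x + h) - f x| <= K * h) -> `|l| <= K.
Proof.
move=> d0 /is_deriveP fl fK; apply/ler_addgt0Pr => e /fl[d1 d10 dP].
pose h := Num.min d d1 / 2.
have m0 : 0 < Num.min d d1 by rewrite lt_min d0.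
have h0 : 0 < h by rewrite divr_gt0.
have : h < Num.min d d1 by rewrite /h; lra.
rewrite lt_min => /andP[hd hd1].
have := dP h; rewrite gtr0_norm // => /(_ hd1) A.
have B : `|f (x + h) - f x| <= K * h by apply: fK; rewrite h0.
rewrite -(ler_pM2r h0) -[X in _ * X <= _](gtr0_norm h0) -normrM.
(* l h is the increment minus the error of the linear approximation *)
have -> : l * h = (f (x + h) - f x) - (f (x + h) - f x - l * h) by lra.
by rewrite (le_trans (ler_normB _ _)) // mulrDl lerD.
Qed.

Lemma derive_unique (f : R -> R) (x l1 l2 : R) :
  is_derive x 1 f l1 -> is_derive x 1 f l2 -> l1 = l2.
Proof. by move=> [_ <-] [_ <-]. Qed.

End Between.

(** * Goursat: exact boundary integrals over rectangles *)

Section Goursat.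
Variable R : realType.
Implicit Types (s t x y r d e : R) (P Q A B : R -> R -> R).

Lemma antiderivative (f : R -> R) (a b : R) : a < b ->
  (forall x, a <= x <= b -> {for x, continuous f}) ->
  exists g : R -> R, forall x, a < x < b -> is_derive x 1 g (f x).
Proof.
move=> ab cf.
have fi : lebesgue_measure.-integrable `[a, b] (EFin \o f).
  apply: continuous_compact_integrable; first exact: segment_compact.
  apply: continuous_in_subspaceT => x; rewrite inE /= in_itv /=; exact: cf.
exists (fun x => \int[lebesgue_measure]_(t in `[a, x]) f t)%R => x /andP[ax xb].
have cfx : {for x, continuous f} by apply: cf; rewrite !ltW.
have [dF <-] := continuous_FTC1_closed xb fi ax cfx.
by split; [exact: dF|rewrite derive1E].
Qed.

(** An exact second order expansion spares the differentiation rules when f is a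
polynomial of degree at most 2. *)
Lemma is_derive_quad (f : R -> R) (x l c : R) :
  (forall h, f (x + h) - f x = l * h + c * h ^+ 2) -> is_derive x 1 f l.
Proof.
move=> fh; apply/is_deriveP => e e0.
have c0 : 0 < `|c| + 1 by rewrite ltr_wpDl.
exists (e / (`|c| + 1)) => [|h]; first by rewrite divr_gt0.
rewrite ltr_pdivlMr // => hd; rewrite fh addrAC subrr add0r normrM normrX expr2 mulrA.
rewrite ler_wpM2r // (le_trans _ (ltW hd)) // mulrC ler_wpM2l //.
by rewrite lerDl.
Qed.

Definition differential_at (u : R -> R -> R) s t us ut :=
  forall e, 0 < e -> exists2 d, 0 < d & forall x y, `|x| < d -> `|y| < d ->
    `|u (s + x) (t + y) - u s t - us * x - ut * y| <= e * (`|x| + `|y|).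

Lemma differential_at_s (u : R -> R -> R) s t us ut :
  differential_at u s t us ut -> is_derive s 1 (u^~ t) us.
Proof.
move=> du; apply/is_deriveP => e /du[d d0 dP]; exists d => // h hd.
by have := dP h 0; rewrite !normr0 mulr0 subr0 !addr0; exact.
Qed.

Lemma differential_at_t (u : R -> R -> R) s t us ut :
  differential_at u s t us ut -> is_derive t 1 (u s) ut.
Proof.
move=> du; apply/is_deriveP => e /du[d d0 dP]; exists d => // h hd.
by have := dP 0 h; rewrite !normr0 mulr0 subr0 !addr0 add0r; exact.
Qed.

(** When A is an antiderivative of P in the first variable and B one of Q in the
second, this is the integral of P ds + Q dt along the boundary of the rectangle,
and additivity in the rectangle becomes an identity of commutative groups. *)
Definition rectangle_form A B s1 s2 t1 t2 :=
  (A s2 t1 - A s1 t1) + (B s2 t2 - B s2 t1)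
  - (A s2 t2 - A s1 t2) - (B s1 t2 - B s1 t1).

Variables (A B P Q : R -> R -> R) (Ps Pt Qt : R -> R -> R) (s0 t0 r : R).
Hypothesis dA : forall s t, `|s - s0| < r -> `|t - t0| < r ->
  is_derive s 1 (A^~ t) (P s t).
Hypothesis dB : forall s t, `|s - s0| < r -> `|t - t0| < r ->
  is_derive t 1 (B s) (Q s t).
Hypothesis dP : forall s t, `|s - s0| < r -> `|t - t0| < r ->
  differential_at P s t (Ps s t) (Pt s t).
Hypothesis dQ : forall s t, `|s - s0| < r -> `|t - t0| < r ->
  differential_at Q s t (Pt s t) (Qt s t).

(** The affine approximation of P ds + Q dt at (s, t) is closed because both mixed
coefficients are [Pt s t], so it has a polynomial primitive T and contributes
nothing.  The mean value theorem on each edge bounds the contribution of the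
remainder by its size, small with respect to the diameter, times the length. *)
Lemma rectangle_form_local s t e : 0 < e -> `|s - s0| < r -> `|t - t0| < r ->
  exists2 d, 0 < d & forall s1 s2 t1 t2,
    s1 <= s <= s2 -> t1 <= t <= t2 -> s2 - s1 < d -> t2 - t1 < d ->
    `|s1 - s0| < r -> `|s2 - s0| < r -> `|t1 - t0| < r -> `|t2 - t0| < r ->
    `|rectangle_form A B s1 s2 t1 t2| <= e * ((s2 - s1) + (t2 - t1)) ^+ 2.
Proof.
move=> e0 sr tr; have e20 : 0 < e / 2 by rewrite divr_gt0.
have [d1 d10 dP1] := dP sr tr e20; have [d2 d20 dP2] := dQ sr tr e20.
exists (Num.min d1 d2) => [|s1 s2 t1 t2]; first by rewrite lt_min d10.
move=> s12 t12; rewrite !lt_min => /andP[wd1 wd2] /andP[hd1 hd2] s1r s2r t1r t2r.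
have [w w_def] : exists w, w = s2 - s1 by exists (s2 - s1).
have [h h_def] : exists h, h = t2 - t1 by exists (t2 - t1).
rewrite -w_def -h_def in wd1 wd2 hd1 hd2 *.
have sw x : between s1 s2 x -> `|x - s| <= w.
  by rewrite w_def; exact: between_width s12.
have th y : between t1 t2 y -> `|y - t| <= h.
  by rewrite h_def; exact: between_width t12.
have b12 (a b : R) : between a b a /\ between a b b.
  by rewrite /between; have [ab|/ltW ab] := leP a b; split;
    [left|left|right|right]; apply/andP.
pose T x y := P s t * (x - s) + Q s t * (y - t) + Ps s t / 2 * (x - s) ^+ 2
  + Pt s t * (x - s) * (y - t) + Qt s t / 2 * (y - t) ^+ 2.
have hor y : between t1 t2 y ->
    `|(A s2 y - T s2 y) - (A s1 y - T s1 y)| <= e / 2 * (w + h) * w.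
  move=> yt; have ew : w = `|s2 - s1|.
    by rewrite w_def ger0_norm // subr_ge0; case/andP: s12; exact: le_trans.
  have yr : `|y - t0| < r by apply: between_ball yt _ _.
  apply: (@le_trans _ _ (e / 2 * (w + h) * `|s2 - s1|)); last by rewrite -ew.
  apply: (@MVT_bound _ (fun x => A x y - T x y)
    (fun x => P x y - (P s t + Ps s t * (x - s) + Pt s t * (y - t)))).
    move=> x xs; have xr : `|x - s0| < r by apply: between_ball xs _ _.
    apply: is_deriveB; first exact: dA.
    by apply: (@is_derive_quad _ _ _ (Ps s t / 2)) => k; rewrite /T; field.
  move=> x xs; have := dP1 (x - s) (y - t).
  rewrite (addrC s) (addrC t) !subrK.
  move=> /(_ (le_lt_trans (sw _ xs) wd1) (le_lt_trans (th _ yt) hd1)).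
  rewrite !opprD !addrA => /le_trans -> //.
  by rewrite ler_wpM2l ?(ltW e20) //; apply: lerD; [exact: sw|exact: th].
have ver x : between s1 s2 x ->
    `|(B x t2 - T x t2) - (B x t1 - T x t1)| <= e / 2 * (w + h) * h.
  move=> xs; have eh : h = `|t2 - t1|.
    by rewrite h_def ger0_norm // subr_ge0; case/andP: t12; exact: le_trans.
  have xr : `|x - s0| < r by apply: between_ball xs _ _.
  apply: (@le_trans _ _ (e / 2 * (w + h) * `|t2 - t1|)); last by rewrite -eh.
  apply: (@MVT_bound _ (fun y => B x y - T x y)
    (fun y => Q x y - (Q s t + Pt s t * (x - s) + Qt s t * (y - t)))).
    move=> y yt; have yr : `|y - t0| < r by apply: between_ball yt _ _.
    apply: is_deriveB; first exact: dB.
    by apply: (@is_derive_quad _ _ _ (Qt s t / 2)) => k; rewrite /T; field.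
  move=> y yt; have := dP2 (x - s) (y - t).
  rewrite (addrC s) (addrC t) !subrK.
  move=> /(_ (le_lt_trans (sw _ xs) wd2) (le_lt_trans (th _ yt) hd2)).
  rewrite !opprD !addrA => /le_trans -> //.
  by rewrite ler_wpM2l ?(ltW e20) //; apply: lerD; [exact: sw|exact: th].
have [bs1 bs2] := b12 s1 s2; have [bt1 bt2] := b12 t1 t2.
have -> : rectangle_form A B s1 s2 t1 t2 =
    ((A s2 t1 - T s2 t1) - (A s1 t1 - T s1 t1))
    + ((B s2 t2 - T s2 t2) - (B s2 t1 - T s2 t1))
    - ((A s2 t2 - T s2 t2) - (A s1 t2 - T s1 t2))
    - ((B s1 t2 - T s1 t2) - (B s1 t1 - T s1 t1)).
  by rewrite /rectangle_form; ring.
have -> : e * (w + h) ^+ 2 =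
    e / 2 * (w + h) * w + e / 2 * (w + h) * h +
    e / 2 * (w + h) * w + e / 2 * (w + h) * h by field.
apply: le_trans (ler_normB _ _) _; apply: lerD; last exact: ver.
apply: le_trans (ler_normB _ _) _; apply: lerD; last exact: hor.
by apply: le_trans (ler_normD _ _) _; apply: lerD; [exact: hor|exact: ver].
Qed.

End Goursat.

(** * Vanishing of the boundary integrals by bisection *)

Section Bisection.
Variable R : realType.
Implicit Types (s t r d e : R).

Lemma ltr_divX2 (x d : R) : 0 < d -> exists n, x / 2 ^+ n < d.
Proof.
move=> d0; set n := Num.bound `|x / d|; exists n.
have nx : `|x / d| < n%:R by exact: archi_boundP.
 have p0 : 0 < 2 ^+ n :> R by rewrite exprn_gt0.
rewrite ltr_pdivrMr // mulrC -ltr_pdivrMr //.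
apply: le_lt_trans (ler_norm _) _; apply: lt_trans nx _.
by rewrite -natrX ltr_nat ltn_expl.
Qed.

Lemma nested_intervals (a w : nat -> R) :
  (forall n, 0 <= w n) ->
  (forall n, a n <= a n.+1 /\ a n.+1 + w n.+1 <= a n + w n) ->
  exists s, forall n, a n <= s <= a n + w n.
Proof.
move=> w0 aw.
have step n k : a n <= a (n + k)%N /\ a (n + k)%N + w (n + k)%N <= a n + w n.
  elim: k => [|k [h1 h2]]; first by rewrite addn0.
  have [h3 h4] := aw (n + k)%N; rewrite addnS.
  by split; [exact: le_trans h3|exact: le_trans h2].
have ub n m : a m <= a n + w n.
  have [nm|/ltnW mn] := leqP n m.
    rewrite -(subnKC nm); have [_] := step n (m - n)%N; apply: le_trans.
    by rewrite lerDl.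
  rewrite -(subnKC mn); have [h _] := step m (n - m)%N.
  by rewrite (le_trans h) // lerDl.
have hs : has_sup (range a).
  split; first by exists (a 0%N), 0%N.
  by exists (a 0%N + w 0%N) => _ [m _ <-].
exists (sup (range a)) => n; apply/andP; split.
  by apply: sup_upper_bound => //; exists n.
by apply: ge_sup; [exists (a 0%N), 0%N|move=> _ [m _ <-]].
Qed.

Variables (A B P Q : R -> R -> R) (Ps Pt Qt : R -> R -> R) (s0 t0 r : R).
Hypothesis dA : forall s t, `|s - s0| < r -> `|t - t0| < r ->
  is_derive s 1 (A^~ t) (P s t).
Hypothesis dB : forall s t, `|s - s0| < r -> `|t - t0| < r ->
  is_derive t 1 (B s) (Q s t).
Hypothesis dP : forall s t, `|s - s0| < r -> `|t - t0| < r ->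
  differential_at P s t (Ps s t) (Pt s t).
Hypothesis dQ : forall s t, `|s - s0| < r -> `|t - t0| < r ->
  differential_at Q s t (Pt s t) (Qt s t).

Let form (c : R * R) w h := rectangle_form A B c.1 (c.1 + w) c.2 (c.2 + h).

(** The integral over a rectangle is the sum of those over its four quarters. *)
Lemma rectangle_form_halve (c : R * R) w h : 0 <= w -> 0 <= h ->
  exists2 c' : R * R,
    `|form c w h| / 4 <= `|form c' (w / 2) (h / 2)| &
    [/\ c.1 <= c'.1, c'.1 + w / 2 <= c.1 + w,
        c.2 <= c'.2 & c'.2 + h / 2 <= c.2 + h].
Proof.
move=> w0 h0; apply: contrapT => no.
have small c' : c.1 <= c'.1 -> c'.1 + w / 2 <= c.1 + w ->
    c.2 <= c'.2 -> c'.2 + h / 2 <= c.2 + h ->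
    `|form c' (w / 2) (h / 2)| < `|form c w h| / 4.
  by move=> ? ? ? ?; rewrite ltNge; apply/negP => ?; apply: no; exists c'.
have ww : w / 2 + w / 2 = w by rewrite -splitr.
have hh : h / 2 + h / 2 = h by rewrite -splitr.
move: (w / 2) (h / 2) ww hh small => v k ww hh small.
have v0 : 0 <= v by rewrite -ww in w0; lra.
have k0 : 0 <= k by rewrite -hh in h0; lra.
have e : form c w h = form c v k + form (c.1 + v, c.2) v k
    + form (c.1, c.2 + k) v k + form (c.1 + v, c.2 + k) v k.
  by rewrite -ww -hh /form /rectangle_form /= !addrA; ring.
have h1 : `|form c v k| < `|form c w h| / 4 by apply: small => /=; lra.
have h2 : `|form (c.1 + v, c.2) v k| < `|form c w h| / 4.
  by apply: small => /=; lra.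
have h3 : `|form (c.1, c.2 + k) v k| < `|form c w h| / 4.
  by apply: small => /=; lra.
have h4 : `|form (c.1 + v, c.2 + k) v k| < `|form c w h| / 4.
  by apply: small => /=; lra.
clear small.
have := ler_normD (form c v k + form (c.1 + v, c.2) v k
    + form (c.1, c.2 + k) v k) (form (c.1 + v, c.2 + k) v k).
have := ler_normD (form c v k + form (c.1 + v, c.2) v k)
  (form (c.1, c.2 + k) v k).
have := ler_normD (form c v k) (form (c.1 + v, c.2) v k).
by rewrite -e; lra.
Qed.

(** Bisection keeps the ratio of the integral to the squared size of the rectangle
from decreasing, whereas that ratio tends to 0 at the point common to the
nested rectangles, by [rectangle_form_local]. *)
Lemma rectangle_form_eq0 s1 s2 t1 t2 : s1 <= s2 -> t1 <= t2 ->
  `|s1 - s0| < r -> `|s2 - s0| < r -> `|t1 - t0| < r -> `|t2 - t0| < r ->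
  rectangle_form A B s1 s2 t1 t2 = 0.
Proof.
move=> s12 t12 s1r s2r t1r t2r.
pose w n := (s2 - s1) / 2 ^+ n; pose h n := (t2 - t1) / 2 ^+ n.
have w0 n : 0 <= w n by rewrite divr_ge0 ?subr_ge0 ?exprn_ge0.
have h0 n : 0 <= h n by rewrite divr_ge0 ?subr_ge0 ?exprn_ge0.
have wS n : w n / 2 = w n.+1 by rewrite /w exprSr invfM mulrA.
have hS n : h n / 2 = h n.+1 by rewrite /h exprSr invfM mulrA.
pose good n (c c' : R * R) :=
  `|form c (w n) (h n)| / 4 <= `|form c' (w n.+1) (h n.+1)| /\
  [/\ c.1 <= c'.1, c'.1 + w n.+1 <= c.1 + w n,
      c.2 <= c'.2 & c'.2 + h n.+1 <= c.2 + h n].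
have /choice[next nextP] (nc : nat * (R * R)) : exists c', good nc.1 nc.2 c'.
  have [c'] := rectangle_form_halve nc.2 (w0 nc.1) (h0 nc.1).
  by rewrite wS hS; exists c'.
(* the lower left corners of the nested rectangles *)
pose c := fix c n := if n is k.+1 then next (k, c k) else (s1, t1).
have cP n : good n (c n) (c n.+1) by exact: (nextP (n, c n)).
have [s sP] : exists s, forall n, (c n).1 <= s <= (c n).1 + w n.
  by apply: nested_intervals => // n; have [_ []] := cP n.
have [t tP] : exists t, forall n, (c n).2 <= t <= (c n).2 + h n.
  by apply: nested_intervals => // n; have [_ []] := cP n.
have inside n : [/\ s1 <= (c n).1, (c n).1 + w n <= s2,
    t1 <= (c n).2 & (c n).2 + h n <= t2].
  elim: n => [|n [i1 i2 i3 i4]].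
    by rewrite /= /w /h expr0 !divr1 !subrKC !lexx.
  have [_ [j1 j2 j3 j4]] := cP n.
  by split; [exact: le_trans j1|exact: le_trans i2|exact: le_trans j3|
    exact: le_trans i4].
pose K := `|rectangle_form A B s1 s2 t1 t2|.
have big n : K / 4 ^+ n <= `|form (c n) (w n) (h n)|.
  elim: n => [|n IH].
    by rewrite expr0 divr1 /form /= /w /h expr0 !divr1 !subrKC.
  have [/(le_trans _)->//] := cP n.
  by rewrite exprSr invfM mulrA ler_pM2r.
apply/eqP; rewrite -normr_le0 -/K.
pose L := (s2 - s1 + (t2 - t1)) ^+ 2.
have L0 : 0 <= L by rewrite sqr_ge0.
have inr x x1 x2 y : x1 <= x -> x <= x2 -> `|x1 - y| < r -> `|x2 - y| < r ->
    `|x - y| < r.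
  by move=> ? ?; apply: between_ball; left; apply/andP.
have sr : `|s - s0| < r.
  by apply: inr s1r s2r; have := sP 0%N; rewrite /= /w expr0 divr1 subrKC => /andP[].
have tr : `|t - t0| < r.
  by apply: inr t1r t2r; have := tP 0%N; rewrite /= /h expr0 divr1 subrKC => /andP[].
suff KL e : 0 < e -> K <= e * L.
  apply/ler_addgt0Pr => e e0; rewrite add0r.
  apply: le_trans (KL (e / (L + 1)) _) _; first by rewrite divr_gt0 // ltr_wpDl.
  by rewrite mulrAC ler_pdivrMr ?ltr_wpDl // ler_pM2l // lerDl.
move=> e0.
have [d d0 loc] := rectangle_form_local dA dB dP dQ e0 sr tr.
have [n nd] := ltr_divX2 (s2 - s1 + (t2 - t1)) d0.
have p0 : 0 < 2 ^+ n :> R by rewrite exprn_gt0.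
have wd : w n < d.
  by apply: le_lt_trans nd; rewrite /w ler_pM2r ?invr_gt0 // lerDl subr_ge0.
have hd : h n < d.
  by apply: le_lt_trans nd; rewrite /h ler_pM2r ?invr_gt0 // lerDr subr_ge0.
have [i1 i2 i3 i4] := inside n.
have j1 : (c n).1 <= (c n).1 + w n by rewrite lerDl.
have j3 : (c n).2 <= (c n).2 + h n by rewrite lerDl.
have := loc (c n).1 ((c n).1 + w n) (c n).2 ((c n).2 + h n) (sP n) (tP n).
rewrite !(addrC _ (w n)) !(addrC _ (h n)) !addrK => /(_ wd hd).
rewrite !(addrC (w n) _.1) !(addrC (h n) _.2) => F.
have := le_trans (big n) (F _ _ _ _).
have -> : e * (w n + h n) ^+ 2 = e * L / 4 ^+ n.
  have -> : 4 ^+ n = 2 ^+ n * 2 ^+ n :> R by rewrite -exprMn; congr (_ ^+ _); ring.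
  by rewrite /w /h /L; field; rewrite gt_eqF.
rewrite ler_pM2r ?invr_gt0 ?exprn_gt0 //; apply.
- by apply: inr s1r s2r => //; exact: le_trans i2.
- by apply: inr s1r s2r => //; exact: le_trans j1.
- by apply: inr t1r t2r => //; exact: le_trans i4.
- by apply: inr t1r t2r => //; exact: le_trans j3.
Qed.

End Bisection.

(** * Primitives of closed differentiable forms *)

Section Primitive.
Variable R : realType.
Implicit Types (s t x y r d e : R) (P Q p u : R -> R -> R).

Definition continuous2 (u : R -> R -> R) s t :=
  forall e, 0 < e -> exists2 d, 0 < d & forall x y, `|x| < d -> `|y| < d ->
    `|u (s + x) (t + y) - u s t| <= e.

Lemma differential_at_continuous2 (u : R -> R -> R) s t us ut :
  differential_at u s t us ut -> continuous2 u s t.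
Proof.
move=> du e e0; have [d d0 dP] := du 1 ltr01.
pose K := `|us| + `|ut| + 2; have K0 : 0 < K by rewrite ltr_wpDl ?addr_ge0.
exists (Num.min d (e / K)) => [|x y]; first by rewrite lt_min d0 divr_gt0.
rewrite !lt_min !ltr_pdivlMr // => /andP[xd xe] /andP[yd ye].
have D := dP _ _ xd yd.
have -> : u (s + x) (t + y) - u s t =
  (u (s + x) (t + y) - u s t - us * x - ut * y) + us * x + ut * y by ring.
apply: le_trans (ler_normD _ _) _.
apply: le_trans (lerD (ler_normD _ _) (lexx _)) _; rewrite !normrM.
have nu : 0 <= `|us| by [].
have nt : 0 <= `|ut| by [].
have nx : 0 <= `|x| by [].
have ny : 0 <= `|y| by [].
rewrite /K in xe ye.
have [xy|/ltW xy] := leP `|x| `|y|.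
  have : `|us| * `|x| <= `|us| * `|y| by rewrite ler_wpM2l.
  by lra.
have : `|ut| * `|y| <= `|ut| * `|x| by rewrite ler_wpM2l.
by lra.
Qed.

(** Locally bounded partial derivatives make a function locally Lipschitz. *)
Lemma partials_continuous2 p P Q (s0 t0 r s t : R) :
  (forall s t, `|s - s0| < r -> `|t - t0| < r ->
    [/\ is_derive s 1 (p^~ t) (P s t), is_derive t 1 (p s) (Q s t),
        continuous2 P s t & continuous2 Q s t]) ->
  `|s - s0| < r -> `|t - t0| < r -> continuous2 p s t.
Proof.
move=> dp sr tr e e0; have [_ _ cP cQ] := dp _ _ sr tr.
have [d1 d10 P1] := cP 1 ltr01; have [d2 d20 Q1] := cQ 1 ltr01.
pose K := `|P s t| + `|Q s t| + 1; have K0 : 0 < K by rewrite ltr_wpDl ?addr_ge0.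
pose d := Num.min (Num.min d1 d2)
  (Num.min (e / K / 2) (Num.min (r - `|s - s0|) (r - `|t - t0|))).
have d0 : 0 < d by rewrite !lt_min d10 d20 !divr_gt0 // !subr_gt0 sr tr.
have bnd x y : `|x| < d -> `|y| < d -> [/\ `|P (s + x) (t + y)| <= K,
    `|Q (s + x) (t + y)| <= K, `|s + x - s0| < r & `|t + y - t0| < r].
  rewrite !lt_min => /andP[/andP[x1 x2] /and3P[_ x3 _]].
  move=> /andP[/andP[y1 y2] /and3P[_ _ y3]].
  have nP := normr_ge0 (P s t); have nQ := normr_ge0 (Q s t); split.
  - have := P1 _ _ x1 y1; have := ler_normD (P (s + x) (t + y) - P s t) (P s t).
    by rewrite subrK /K; lra.
  - have := Q1 _ _ x2 y2; have := ler_normD (Q (s + x) (t + y) - Q s t) (Q s t).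
    by rewrite subrK /K; lra.
  - by rewrite addrAC; apply: le_lt_trans (ler_normD _ _) _; rewrite -ltrBrDl.
  - by rewrite addrAC; apply: le_lt_trans (ler_normD _ _) _; rewrite -ltrBrDl.
exists d => // x y xd yd.
have btw a c z : between a (a + c) z -> exists2 k, `|k| <= `|c| & z = a + k.
  move=> /between_dist; rewrite addrAC subrr add0r => zk.
  by exists (z - a); rewrite // subrKC.
have dx z : between s (s + x) z ->
    is_derive z 1 (p^~ (t + y)) (P z (t + y)) /\ `|P z (t + y)| <= K.
  move=> /btw[k kx ->]; have kd := le_lt_trans kx xd.
  have [? ? sr' tr'] := bnd _ _ kd yd.
  by have [] := dp _ _ sr' tr'.
have dy z : between t (t + y) z ->
    is_derive z 1 (p s) (Q s z) /\ `|Q s z| <= K.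
  move=> /btw[k ky ->]; have kd := le_lt_trans ky yd.
  have [|_ Qb sr' tr'] := @bnd 0 k _ kd; first by rewrite normr0.
  by rewrite addr0 in Qb sr'; have [] := dp _ _ sr' tr'.
have h1 := MVT_bound (fun z zb => (dx z zb).1) (fun z zb => (dx z zb).2).
have h2 := MVT_bound (fun z zb => (dy z zb).1) (fun z zb => (dy z zb).2).
rewrite /= !(addrAC _ _ (- _)) !subrr !add0r in h1 h2.
have -> : p (s + x) (t + y) - p s t =
  p (s + x) (t + y) - p s (t + y) + (p s (t + y) - p s t) by ring.
apply: le_trans (ler_normD _ _) _.
have xe : `|x| < e / K / 2 by move: xd; rewrite !lt_min => /and3P[_ ? _].
have ye : `|y| < e / K / 2 by move: yd; rewrite !lt_min => /and3P[_ ? _].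
have h3 : K * `|x| <= K * (e / K / 2) by rewrite ler_pM2l // ltW.
have h4 : K * `|y| <= K * (e / K / 2) by rewrite ler_pM2l // ltW.
have -> : e = K * (e / K / 2) + K * (e / K / 2) by field; rewrite gt_eqF.
by apply: lerD; [exact: le_trans h3|exact: le_trans h4].
Qed.

(** The primitive integrates P ds + Q dt along the lower and right edges of the
rectangle from the corner (s0 - r, t0 - r); its derivative in t is then clear.
Since the boundary integral vanishes, the path along the left and upper edges
gives the same function, whose derivative in s is clear. *)
Lemma closed_form_primitive P Q (Ps Pt Qt : R -> R -> R) (s0 t0 r : R) :
  0 < r ->
  (forall s t, `|s - s0| < 3 * r -> `|t - t0| < 3 * r ->
    differential_at P s t (Ps s t) (Pt s t) /\
    differential_at Q s t (Pt s t) (Qt s t)) ->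
  exists p : R -> R -> R, forall s t, `|s - s0| < r -> `|t - t0| < r ->
    [/\ is_derive s 1 (p^~ t) (P s t), is_derive t 1 (p s) (Q s t) &
        continuous2 p s t].
Proof.
move=> r0 dPQ.
have in2 x y : `|x - y| < 2 * r -> y - 2 * r < x < y + 2 * r.
  by rewrite ltr_norml => /andP[? ?]; apply/andP; split; lra.
have in3 x y : y - 2 * r <= x <= y + 2 * r -> `|x - y| < 3 * r.
  by move=> /andP[? ?]; rewrite ltr_norml; apply/andP; split; lra.
have w32 x : x < 2 * r -> x < 3 * r by move=> ?; lra.
have w12 x : x < r -> x < 2 * r by move=> ?; lra.
have /choice[At AtP] t : exists g : R -> R, `|t - t0| < 2 * r ->
    forall s, `|s - s0| < 2 * r -> is_derive s 1 g (P s t).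
  have [tr|ntr] := boolP (`|t - t0| < 2 * r); last by exists (fun=> 0).
  have [||g gP] := @antiderivative _ (P^~ t) (s0 - 2 * r) (s0 + 2 * r).
  - by lra.
  - move=> x /in3 xr; have [dP _] := dPQ _ _ xr (w32 _ tr).
    exact: is_derive_continuous (differential_at_s dP).
  - by exists g => _ s /in2; exact: gP.
have /choice[B BP] s : exists g : R -> R, `|s - s0| < 2 * r ->
    forall t, `|t - t0| < 2 * r -> is_derive t 1 g (Q s t).
  have [sr|nsr] := boolP (`|s - s0| < 2 * r); last by exists (fun=> 0).
  have [||g gP] := @antiderivative _ (Q s) (t0 - 2 * r) (t0 + 2 * r).
  - by lra.
  - move=> x /in3 xr; have [_ dQ] := dPQ _ _ (w32 _ sr) xr.
    exact: is_derive_continuous (differential_at_t dQ).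
  - by exists g => _ t /in2; exact: gP.
pose A s t := At t s.
have dA s t : `|s - s0| < 2 * r -> `|t - t0| < 2 * r ->
  is_derive s 1 (A^~ t) (P s t) by move=> sr tr; exact: AtP.
have dB s t : `|s - s0| < 2 * r -> `|t - t0| < 2 * r ->
  is_derive t 1 (B s) (Q s t) by move=> sr tr; exact: BP.
have dP s t : `|s - s0| < 2 * r -> `|t - t0| < 2 * r ->
    differential_at P s t (Ps s t) (Pt s t).
  by move=> /w32 sr /w32 tr; have [] := dPQ _ _ sr tr.
have dQ s t : `|s - s0| < 2 * r -> `|t - t0| < 2 * r ->
    differential_at Q s t (Pt s t) (Qt s t).
  by move=> /w32 sr /w32 tr; have [] := dPQ _ _ sr tr.
pose sb := s0 - r; pose tb := t0 - r.
have bb (x : R) : `|x - r - x| < 2 * r.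
  by rewrite addrAC subrr add0r normrN gtr0_norm //; lra.
have ge x y : `|x - y| < r -> y - r <= x.
  by rewrite ltr_norml => /andP[? ?]; lra.
exists (fun s t => A s tb - A sb tb + (B s t - B s tb)).
set p := (X in forall s t, _ -> _ -> [/\ _ , is_derive t 1 (X s) _ & _]).
suff main s t : `|s - s0| < r -> `|t - t0| < r ->
    is_derive s 1 (p^~ t) (P s t) /\ is_derive t 1 (p s) (Q s t).
  move=> s t sr tr; have [h1 h2] := main s t sr tr; split=> //.
  apply: (@partials_continuous2 p P Q s0 t0 r) => // s' t' sr' tr'.
  have [] := main s' t' sr' tr'; split=> //.
    exact: differential_at_continuous2 (dP _ _ (w12 _ sr') (w12 _ tr')).
  exact: differential_at_continuous2 (dQ _ _ (w12 _ sr') (w12 _ tr')).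
move=> sr tr; split; last first.
  have := dB s t (w12 _ sr) (w12 _ tr) => /is_deriveP D; apply/is_deriveP => e.
  move=> /D[d d0 dd]; exists d => // h /dd.
  by rewrite /p; congr (`|_ - _| <= _); ring.
pose q s' := B sb t - B sb tb + (A s' t - A sb t).
apply: (@is_derive_near _ q _ _ _ (r - `|s - s0|)); first by rewrite subr_gt0.
  move=> y ys; have yr : `|y - s0| < r.
    have -> : y - s0 = (y - s) + (s - s0) by ring.
    by apply: le_lt_trans (ler_normD _ _) _; rewrite -ltrBrDr.
  have := rectangle_form_eq0 dA dB dP dQ (ge _ _ yr) (ge _ _ tr) (bb s0)
    (w12 _ yr) (bb t0) (w12 _ tr).
  by rewrite /rectangle_form -/sb -/tb /p /q => /eqP; rewrite -subr_eq0 => /eqP E; lra.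
have := dA s t (w12 _ sr) (w12 _ tr) => /is_deriveP D; apply/is_deriveP => e.
move=> /D[d d0 dd]; exists d => // h /dd.
by rewrite /q; congr (`|_ - _| <= _); ring.
Qed.

End Primitive.

(** * The weak maximum principle *)

Section MaximumPrinciple.
Variable R : realType.
Implicit Types (s t x y r d e : R) (u us uss ut utt : R -> R -> R).

(** If l were positive, the derivative g would be positive just to the right of its
zero x and f would increase there. *)
Lemma second_derivative_max (f g : R -> R) (x l d : R) : 0 < d ->
  (forall y, `|y - x| < d -> is_derive y 1 f (g y)) ->
  is_derive x 1 g l ->
  (forall y, `|y - x| < d -> f y <= f x) -> l <= 0.
Proof.
move=> d0 df dg fmax.
have itvd y : y \in `]x - d, x + d[%R -> `|y - x| < d.
  by rewrite in_itv /= ltr_norml => /andP[? ?]; apply/andP; split; lra.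
have gx0 : g x = 0.
  have xx : `|x - x| < d by rewrite subrr normr0.
  apply: derive_unique (df x xx) _.
  apply: (@derive1_at_max _ f (x - d) (x + d)).
  - by lra.
  - by move=> y /itvd /df[].
  - by rewrite in_itv /=; apply/andP; split; lra.
  - by move=> y /itvd; exact: fmax.
rewrite leNgt; apply/negP => l0.
have l20 : 0 < l / 2 by rewrite divr_gt0.
have /is_deriveP/(_ _ l20)[d1 d10 dP] := dg.
pose h := Num.min d d1 / 2.
have m0 : 0 < Num.min d d1 by rewrite lt_min d0.
have h0 : 0 < h by rewrite divr_gt0.
have : h < Num.min d d1 by rewrite /h; lra.
rewrite lt_min => /andP[hd hd1].
have xh : x < x + h by rewrite ltrDl.
have dfh y : x <= y <= x + h -> is_derive y 1 f (g y).
  by move=> /andP[? ?]; apply: df; rewrite ltr_norml; apply/andP; split; lra.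
have [||c] := @MVT _ f g x (x + h) xh.
- by move=> y; rewrite in_itv /= => /andP[/ltW y1 /ltW y2]; apply: dfh; rewrite y1.
- apply: continuous_in_subspaceT => y; rewrite inE /= in_itv /= => /dfh.
  exact: is_derive_continuous.
rewrite in_itv /= addrAC subrr add0r => /andP[xc ch] E.
have /fmax : `|x + h - x| < d by rewrite addrAC subrr add0r gtr0_norm.
rewrite -subr_le0 E pmulr_lle0 // => gc.
have k0 : 0 < c - x by rewrite subr_gt0.
have := dP (c - x); rewrite gtr0_norm // subrKC gx0 subr0.
have kd : c - x < d1 by lra.
move=> /(_ kd); rewrite ler_norml => /andP[k1 _].
have : 0 < l / 2 * (c - x) by rewrite mulr_gt0.
by lra.
Qed.

(** Adding a small multiple of (s - s1) ^ 2 makes the Laplacian positive, so that an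
interior maximum contradicts the second derivative test. *)
Lemma maximum_principle u us uss ut utt (s1 s2 t1 t2 : R) :
  (forall s t, s1 <= s <= s2 -> t1 <= t <= t2 -> continuous2 u s t) ->
  (forall s t, s1 < s < s2 -> t1 < t < t2 ->
    [/\ is_derive s 1 (u^~ t) (us s t), is_derive s 1 (us^~ t) (uss s t),
        is_derive t 1 (u s) (ut s t), is_derive t 1 (ut s) (utt s t) &
        0 <= uss s t + utt s t]) ->
  (forall s t, s1 <= s <= s2 -> t1 <= t <= t2 ->
    [|| s == s1, s == s2, t == t1 | t == t2] -> u s t <= 0) ->
  forall s t, s1 <= s <= s2 -> t1 <= t <= t2 -> u s t <= 0.
Proof.
move=> cu du ub s t sI tI.
(* L bounds (s - s1) ^ 2, hence v <= u and v <= 0 on the boundary *)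
pose L := (s2 - s1) ^+ 2; have L0 : 0 <= L by rewrite sqr_ge0.
suff small e : 0 < e -> u s t <= e * L.
  apply/ler_addgt0Pr => e e0; rewrite add0r.
  apply: le_trans (small (e / (L + 1)) _) _; first by rewrite divr_gt0 // ltr_wpDl.
  by rewrite mulrAC ler_pdivrMr ?ltr_wpDl // ler_pM2l // lerDl.
move=> e0; pose v x y := u x y + e * ((x - s1) ^+ 2 - L).
have vu x y : s1 <= x <= s2 -> v x y <= u x y.
  move=> /andP[x1 x2]; rewrite /v gerDl pmulr_rle0 // subr_le0 /L.
  by rewrite ler_sqr ?nnegrE ?subr_ge0 ?lerB // (le_trans x1).
suff v0 : v s t <= 0.
  have := sqr_ge0 (s - s1); move: v0; rewrite /v mulrBr => v0 q0.
  have : 0 <= e * (s - s1) ^+ 2 by rewrite mulr_ge0 // ltW.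
  by lra.
pose A := `[s1, s2]%classic `*` `[t1, t2]%classic.
have cA : compact A by apply: compact_setX; exact: segment_compact.
have A0 : A !=set0 by exists (s, t); rewrite /A /= !in_itv.
have cv : {within A, continuous (fun z : R * R => v z.1 z.2)}.
  apply: continuous_in_subspaceT => -[x y].
  rewrite inE /A /= !in_itv /= => -[xI yI].
  have cont_u : {for (x, y), continuous (fun z : R * R => u z.1 z.2)}.
    apply/cvgrPdist_le => /= k k0; have [d d0 dP] := cu _ _ xI yI k k0.
    exists (ball x d, ball y d) => /= [|[x' y'] [/= bx by']].
      by split; exact: nbhsx_ballx.
    have := dP (x' - x) (y' - y); rewrite !subrKC => H; rewrite distrC; apply: H.
      by rewrite distrC.
    by rewrite distrC.
  have c1 : {for (x, y), continuous (fun z : R * R => z.1 - s1)}.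
    by apply: cvgB; [exact: cvg_fst|exact: cvg_cst].
  apply: cvgD => //; apply: cvgM; first exact: cvg_cst.
  by apply: cvgB; [apply: cvgM|exact: cvg_cst].
have [[c1 c2]] := compact_EVT_max A0 cA cv.
rewrite inE /A /= !in_itv /= => -[c1I c2I] vmax.
have {}vmax x y : s1 <= x <= s2 -> t1 <= y <= t2 -> v x y <= v c1 c2.
  by move=> xI yI; apply: (vmax (x, y)); rewrite inE /A /= !in_itv.
apply: le_trans (vmax _ _ sI tI) _.
have [bd|] := boolP [|| c1 == s1, c1 == s2, c2 == t1 | c2 == t2].
  by apply: le_trans (vu _ _ c1I) _; exact: ub.
rewrite !negb_or => /and4P[n1 n2 n3 n4].
have {n1 n2}c1o : s1 < c1 < s2.
  by rewrite !lt_neqAle (eq_sym s1) n1 n2; move: c1I => /andP[-> ->].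
have {n3 n4}c2o : t1 < c2 < t2.
  by rewrite !lt_neqAle (eq_sym t1) n3 n4; move: c2I => /andP[-> ->].
have room (a b x : R) : a < x < b -> exists2 d, 0 < d &
    forall y, `|y - x| < d -> a < y < b.
  move=> /andP[ax xb]; exists (Num.min (x - a) (b - x)) => [|y].
    by rewrite lt_min !subr_gt0 ax.
  rewrite lt_min !ltr_norml => /andP[/andP[? ?] /andP[? ?]].
  by apply/andP; split; lra.
have cc (a b x : R) : a < x < b -> a <= x <= b by case/andP=> /ltW-> /ltW->.
have [_ dss _ dtt lap] := du _ _ c1o c2o.
have ss : uss c1 c2 + 2 * e <= 0.
  have [d d0 dP] := room _ _ _ c1o.
  apply: (@second_derivative_max (v^~ c2)
    (fun x => us x c2 + e * (2 * (x - s1))) c1 _ d d0).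
  - move=> y yd; have [dy _ _ _ _] := du _ _ (dP _ yd) c2o.
    by apply: is_deriveD; apply: (@is_derive_quad _ _ _ _ e) => h; ring.
  - by apply: is_deriveD; apply: (@is_derive_quad _ _ _ _ 0) => h; ring.
  - by move=> y /dP /cc yI; exact: vmax.
have tt : utt c1 c2 <= 0.
  have [d d0 dP] := room _ _ _ c2o.
  apply: (@second_derivative_max (v c1) (ut c1) c2 _ d d0).
  - move=> y yd; have [_ _ dy _ _] := du _ _ c1o (dP _ yd).
    have dc : is_derive y 1 (fun=> e * ((c1 - s1) ^+ 2 - L) : R) 0.
      exact: is_derive_cst.
    by rewrite -[ut c1 y]addr0; exact: is_deriveD dy dc.
  - by move=> y /dP /cc yI; exact: vmax.
by lra.
Qed.

End MaximumPrinciple.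

(** * Gradient bound for harmonic functions of two variables *)

Section HarmonicEstimates.
Variable R : realType.
Implicit Types (s t x y r d e h k M : R) (u us uss ut : R -> R -> R).

(** The derivatives are part of the data, and the Laplace equation is expressed by
the derivative of [ut] in t being the opposite of [uss]: this is what the
primitive of a merely differentiable closed form provides. *)
Definition harmonic_on (s0 t0 r : R) u us uss ut :=
  forall s t, `|s - s0| < r -> `|t - t0| < r ->
    [/\ continuous2 u s t,
        is_derive s 1 (u^~ t) (us s t), is_derive s 1 (us^~ t) (uss s t),
        is_derive t 1 (u s) (ut s t) & is_derive t 1 (ut s) (- uss s t)].

Lemma continuous2_lin u v (a b : R) s t : continuous2 u s t ->
  continuous2 v s t -> continuous2 (fun x y => a * u x y + b * v x y) s t.
Proof.
move=> cu cv e e0; pose K := `|a| + `|b| + 1.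
have K0 : 0 < K by rewrite ltr_wpDl ?addr_ge0.
have eK : 0 < e / K by rewrite divr_gt0.
have [d1 d10 P1] := cu _ eK; have [d2 d20 P2] := cv _ eK.
exists (Num.min d1 d2) => [|x y]; first by rewrite lt_min d10.
rewrite !lt_min => /andP[x1 x2] /andP[y1 y2].
have -> : a * u (s + x) (t + y) + b * v (s + x) (t + y)
    - (a * u s t + b * v s t) =
  a * (u (s + x) (t + y) - u s t) + b * (v (s + x) (t + y) - v s t) by ring.
apply: le_trans (ler_normD _ _) _; rewrite !normrM.
have h1 : `|a| * `|u (s + x) (t + y) - u s t| <= `|a| * (e / K).
  by rewrite ler_wpM2l // P1.
have h2 : `|b| * `|v (s + x) (t + y) - v s t| <= `|b| * (e / K).
  by rewrite ler_wpM2l // P2.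
apply: le_trans (lerD h1 h2) _.
apply: (@le_trans _ _ (K * (e / K))); last by rewrite mulrC divfK ?gt_eqF.
by rewrite -mulrDl ler_pM2r // /K lerDl.
Qed.

Lemma continuous2_reflect u (a b : R) s t :
  continuous2 u (a - s) t -> continuous2 (fun x y => u (a - x) y) s t.
Proof.
move=> cu e /cu[d d0 dP]; exists d => // x y xd yd.
by rewrite opprD addrA; apply: dP; rewrite // normrN.
Qed.

Lemma is_derive_lin (f g : R -> R) (a b x l m : R) :
  is_derive x 1 f l -> is_derive x 1 g m ->
  is_derive x 1 (fun y => a * f y + b * g y) (a * l + b * m).
Proof. by move=> df dg; apply: is_deriveD. Qed.

Lemma harmonic_lin s0 t0 r u us uss ut v vs vss vt (a b : R) :
  harmonic_on s0 t0 r u us uss ut -> harmonic_on s0 t0 r v vs vss vt ->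
  harmonic_on s0 t0 r (fun x y => a * u x y + b * v x y)
    (fun x y => a * us x y + b * vs x y)
    (fun x y => a * uss x y + b * vss x y)
    (fun x y => a * ut x y + b * vt x y).
Proof.
move=> hu hv s t sr tr.
have [u1 u2 u3 u4 u5] := hu s t sr tr; have [v1 v2 v3 v4 v5] := hv s t sr tr.
split; [exact: continuous2_lin|exact: is_derive_lin|exact: is_derive_lin|
  exact: is_derive_lin|].
by rewrite opprD -!mulrN; exact: is_derive_lin.
Qed.

Lemma harmonic_sub s0 t0 r s1 t1 r1 u us uss ut :
  `|s1 - s0| <= r - r1 -> `|t1 - t0| <= r - r1 ->
  harmonic_on s0 t0 r u us uss ut -> harmonic_on s1 t1 r1 u us uss ut.
Proof.
move=> s10 t10 hu s t sr tr; apply: hu.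
  have -> : s - s0 = (s - s1) + (s1 - s0) by ring.
  by apply: le_lt_trans (ler_normD _ _) _; lra.
have -> : t - t0 = (t - t1) + (t1 - t0) by ring.
by apply: le_lt_trans (ler_normD _ _) _; lra.
Qed.

Lemma harmonic_shift s0 t0 r (a : R) u us uss ut :
  harmonic_on (s0 + a) t0 r u us uss ut ->
  harmonic_on s0 t0 r (fun x y => u (x + a) y) (fun x y => us (x + a) y)
    (fun x y => uss (x + a) y) (fun x y => ut (x + a) y).
Proof.
move=> hu s t sr tr.
have sr' : `|s + a - (s0 + a)| < r by rewrite opprD addrACA subrr addr0.
have [u1 u2 u3 u4 u5] := hu _ _ sr' tr.
split=> //; try exact: is_derive_translate.
move=> e /u1[d d0 dP]; exists d => // x y xd yd.
by rewrite (addrAC s); exact: dP.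
Qed.

(** The difference quotient in the first variable, written as a linear combination
of translates so that [harmonic_lin] applies. *)
Definition quot u k : R -> R -> R :=
  fun x y => k^-1 * u (x + k) y + - k^-1 * u x y.

Lemma harmonic_quot s0 t0 r k u us uss ut :
  harmonic_on s0 t0 r u us uss ut ->
  harmonic_on s0 t0 (r - `|k|) (quot u k) (quot us k) (quot uss k) (quot ut k).
Proof.
move=> hu; apply: harmonic_lin.
  apply: harmonic_shift; apply: harmonic_sub hu.
    by rewrite addrAC subrr add0r; lra.
  by rewrite subrr normr0 subr_ge0 gerBl.
by apply: harmonic_sub hu; rewrite subrr normr0 subr_ge0 gerBl.
Qed.

(** The odd part w of u with respect to the line s = s0 vanishes on that line and is
at most 2 M on the half square.  The harmonic polynomial b vanishes at the centre,
is nonnegative on that line and at least 2 M on the other three sides.  Hence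
|w| <= b on the half square, and comparing derivatives at the centre gives the
bound. *)
Lemma harmonic_gradient s0 t0 r e M u us uss ut : 0 < e -> e < r ->
  harmonic_on s0 t0 r u us uss ut ->
  (forall s t, `|s - s0| <= e -> `|t - t0| <= e -> `|u s t| <= M) ->
  `|us s0 t0| <= 2 * M / e.
Proof.
move=> e0 er hu uM.
have M0 : 0 <= M.
  by apply: le_trans (uM s0 t0 _ _); rewrite ?subrr ?normr0 // ltW.
have [c cE] : exists c : R, c = 2 * M / e ^+ 2 by exists (2 * M / e ^+ 2).
have c0 : 0 <= c by rewrite cE divr_ge0 ?mulr_ge0 ?exprn_ge0 // ltW.
pose b x y : R := c * ((y - t0) ^+ 2 - x ^+ 2 + 2 * e * x).
pose w x y := u (x + s0) y - u (s0 - x) y.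
have inx x : 0 <= x <= e -> `|x + s0 - s0| <= e /\ `|s0 - x - s0| <= e.
  by move=> /andP[x0 xe]; rewrite addrK addrAC subrr add0r normrN ger0_norm.
have iny y : t0 - e <= y <= t0 + e -> `|y - t0| <= e.
  by move=> /andP[? ?]; rewrite ler_norml; apply/andP; split; lra.
have cw s x y : 0 <= x <= e -> t0 - e <= y <= t0 + e ->
    continuous2 (fun x y => s * w x y + -1 * b x y) x y.
  move=> xI yI; have [x1 x2] := inx _ xI; have y1 := iny _ yI.
  have [u1 _ _ _ _] := hu _ _ (le_lt_trans x1 er) (le_lt_trans y1 er).
  have [v1 _ _ _ _] := hu _ _ (le_lt_trans x2 er) (le_lt_trans y1 er).
  apply: continuous2_lin.
    have -> : w = fun x y => 1 * u (x + s0) y + -1 * u (s0 - x) y.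
      by apply/funext => z1; apply/funext => z2; rewrite /w mul1r mulN1r.
    apply: continuous2_lin; last exact: continuous2_reflect.
    by move=> k /u1[d d0 dP]; exists d => // z1 z2; rewrite (addrAC x); exact: dP.
  apply: (@differential_at_continuous2 _ _ _ _
    (c * (- 2 * x + 2 * e)) (c * (2 * (y - t0)))).
  move=> k k0; have c10 : 0 < c + 1 by rewrite ltr_wpDl.
  exists (k / (c + 1)) => [|z1 z2]; first by rewrite divr_gt0.
  rewrite !ltr_pdivlMr // => z1k z2k.
  have -> : b (x + z1) (y + z2) - b x y - c * (- 2 * x + 2 * e) * z1
    - c * (2 * (y - t0)) * z2 = c * z2 ^+ 2 - c * z1 ^+ 2 by rewrite /b; ring.
  apply: le_trans (ler_normB _ _) _; rewrite !normrM !(ger0_norm c0) addrC.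
  have sq z : `|z| * (c + 1) < k -> c * (`|z| * `|z|) <= k * `|z|.
    move=> zk; rewrite mulrA ler_wpM2r // mulrC.
    by apply: le_trans (ltW zk); rewrite ler_wpM2l // lerDl.
  by rewrite mulrDr; apply: lerD; exact: sq.
have wb s : `|s| <= 1 -> forall x y, 0 <= x <= e -> t0 - e <= y <= t0 + e ->
    s * w x y + -1 * b x y <= 0.
  move=> s1; apply: (@maximum_principle _ _
    (fun x y => s * (us (x + s0) y - - us (s0 - x) y)
       + -1 * (c * (- 2 * x + 2 * e)))
    (fun x y => s * (uss (x + s0) y - uss (s0 - x) y) + -1 * (- 2 * c))
    (fun x y => s * (ut (x + s0) y - ut (s0 - x) y) + -1 * (c * (2 * (y - t0))))
    (fun x y => s * (- uss (x + s0) y - - uss (s0 - x) y) + -1 * (2 * c))).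
  - by move=> x y; exact: cw.
  - move=> x y /andP[/ltW x0 /ltW xe] /andP[/ltW y0 /ltW ye].
    have [x1 x2] := inx x (introT andP (conj x0 xe)).
    have y1 := iny y (introT andP (conj y0 ye)).
    have [_ u1 u2 u3 u4] := hu _ _ (le_lt_trans x1 er) (le_lt_trans y1 er).
    have [_ v1 v2 v3 v4] := hu _ _ (le_lt_trans x2 er) (le_lt_trans y1 er).
    split.
    + apply: is_derive_lin.
        apply: is_deriveB; first exact: is_derive_translate.
        exact: is_derive_reflect.
      by apply: (@is_derive_quad _ _ _ _ (- c)) => z; rewrite /b; ring.
    + apply: is_derive_lin.
        apply: is_deriveB; first exact: is_derive_translate.
        by rewrite -[uss (s0 - x) y]opprK; apply: is_deriveN; exact: is_derive_reflect.
      by apply: (@is_derive_quad _ _ _ _ 0) => z; ring.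
    + apply: is_derive_lin.
      by apply: (@is_derive_quad _ _ _ _ c) => z; rewrite /b; ring.
    + apply: is_derive_lin.
      by apply: (@is_derive_quad _ _ _ _ 0) => z; ring.
    + have -> : s * (uss (x + s0) y - uss (s0 - x) y) + -1 * (-2 * c) +
        (s * (- uss (x + s0) y - - uss (s0 - x) y) + -1 * (2 * c)) = 0 by ring.
      by [].
  - move=> x y xI yI bd; have [x1 x2] := inx _ xI; have y1 := iny _ yI.
    have /andP[x0 xe] := xI.
    have q0 : 0 <= (y - t0) ^+ 2 by rewrite sqr_ge0.
    have xx : 0 <= x * (2 * e - x) by apply: mulr_ge0 => //; lra.
    rewrite mulN1r subr_le0.
    case: (eqVneq x 0) => [x00|xn0].
      rewrite /w /b x00 add0r subr0 subrr mulr0 mulr_ge0 //; lra.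
    have e20 : 0 < e ^+ 2 by rewrite exprn_gt0.
    have big : e ^+ 2 <= (y - t0) ^+ 2 - x ^+ 2 + 2 * e * x.
      case/or4P: bd => /eqP E; first by rewrite E eqxx in xn0.
      - by rewrite E; lra.
      - by rewrite E; lra.
      - by rewrite E; lra.
    apply: (@le_trans _ _ (2 * M)); last first.
      apply: (@le_trans _ _ (c * e ^+ 2)); last by rewrite ler_wpM2l.
      by rewrite cE divfK ?gt_eqF.
    apply: le_trans (ler_norm _) _; rewrite normrM.
    apply: (@le_trans _ _ (1 * `|w x y|)); first by rewrite ler_wpM2r.
    rewrite mul1r; apply: le_trans (ler_normB _ _) _.
    by have := uM _ _ x1 y1; have := uM _ _ x2 y1; lra.
have t0I : t0 - e <= t0 <= t0 + e by apply/andP; split; lra.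
have dw : is_derive (0 : R) (1 : R) (w^~ t0) (us s0 t0 - - us s0 t0).
  have [||_ u1 _ _ _] := hu s0 t0; rewrite ?subrr ?normr0 ?(lt_trans e0) //.
  have d1 : is_derive (0 : R) (1 : R) (fun x => u (x + s0) t0) (us s0 t0).
    by apply: (@is_derive_translate _ (u^~ t0)); rewrite add0r.
  have d2 : is_derive (0 : R) (1 : R) (fun x => u (s0 - x) t0) (- us s0 t0).
    by apply: (@is_derive_reflect _ (u^~ t0)); rewrite subr0.
  exact: (is_deriveB d1 d2).
have bound2 : `|us s0 t0 - - us s0 t0| <= 2 * (2 * M / e).
  apply: (derive_bound e0 dw) => h /andP[h0 he].
  have hI : 0 <= h <= e by rewrite !ltW.
  have -> : w 0 t0 = 0 by rewrite /w add0r subr0 subrr.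
  rewrite add0r subr0.
  have bh : b h t0 <= 2 * (2 * M / e) * h.
    have -> : 2 * (2 * M / e) * h = b h t0 + c * h ^+ 2.
      by rewrite /b cE; field; rewrite (gt_eqF e0).
    by rewrite lerDl mulr_ge0 // sqr_ge0.
  have n1 : `|1 : R| <= 1 by rewrite normr1.
  have n2 : `|-1 : R| <= 1 by rewrite normrN1.
  have p1 := wb _ n1 _ _ hI t0I; have p2 := wb _ n2 _ _ hI t0I.
  by rewrite ler_norml; apply/andP; split; lra.
have : 2 * `|us s0 t0| <= 2 * (2 * M / e).
  have -> : 2 * `|us s0 t0| = `|us s0 t0 - - us s0 t0|.
    have -> : us s0 t0 - - us s0 t0 = 2 * us s0 t0 by ring.
    by rewrite normrM ger0_norm.
  exact: bound2.
by rewrite ler_pM2l.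
Qed.

End HarmonicEstimates.

(** * Second derivatives of conjugate functions *)

Section Smoothness.
Variable R : realType.
Implicit Types (s t x y r d e h k M : R) (u us uss ut : R -> R -> R).

Lemma ball_trans (a b c r r' : R) : `|a - b| <= r -> `|b - c| <= r' ->
  `|a - c| <= r + r'.
Proof.
move=> ab bc; have -> : a - c = (a - b) + (b - c) by ring.
by apply: le_trans (ler_normD _ _) _; exact: lerD.
Qed.

Lemma quot_bound u us k L s t : k != 0 ->
  (forall x, between s (s + k) x -> is_derive x 1 (u^~ t) (us x t)) ->
  (forall x, between s (s + k) x -> `|us x t| <= L) ->
  `|quot u k s t| <= L.
Proof.
move=> k0 du uL; have k1 : 0 < `|k| by rewrite normr_gt0.
have := MVT_bound du uL; rewrite addrAC subrr add0r => h.
have -> : quot u k s t = (u (s + k) t - u s t) / k by rewrite /quot; field.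
by rewrite normrM normfV ler_pdivrMr.
Qed.

(** The gradient bound is applied first to u and then to its difference quotients,
which are bounded by the supremum of |us| and whose gradient, a difference
quotient of us, tends to uss. *)
Lemma harmonic_second s0 t0 r e M u us uss ut : 0 < e -> 3 * e < r ->
  harmonic_on s0 t0 r u us uss ut ->
  (forall s t, `|s - s0| <= 3 * e -> `|t - t0| <= 3 * e -> `|u s t| <= M) ->
  `|uss s0 t0| <= 4 * M / e ^+ 2.
Proof.
move=> e0 er hu uM.
have usM s t : `|s - s0| <= 2 * e -> `|t - t0| <= 2 * e ->
    `|us s t| <= 2 * M / e.
  move=> sr tr; apply: (@harmonic_gradient _ _ _ (r - 2 * e) _ _ u us uss ut) => //.
  - by lra.
  - by apply: harmonic_sub hu; lra.
  move=> x y xs yt; apply: uM.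
    by apply: le_trans (ball_trans xs sr) _; lra.
  by apply: le_trans (ball_trans yt tr) _; lra.
have [||_ _ ds _ _] := hu s0 t0; try by rewrite subrr normr0; lra.
apply: (derive_bound e0 ds) => k /andP[k0 ke].
have kn : `|k| = k by rewrite gtr0_norm.
have hq := harmonic_quot (k := k) hu.
have [||_ q1 _ _ _] := hq s0 t0; try by rewrite subrr normr0 kn; lra.
have : `|quot us k s0 t0| <= 2 * (2 * M / e) / e.
  apply: (harmonic_gradient e0 _ hq); first by rewrite kn; lra.
  move=> s t sr tr; apply: (@quot_bound u us); first by rewrite gt_eqF.
    move=> x xs; have xk := between_dist xs; rewrite addrAC subrr add0r kn in xk.
    have xr : `|x - s0| < r by apply: le_lt_trans (ball_trans xk sr) _; lra.
    have tr' : `|t - t0| < r by lra.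
    by have [] := hu _ _ xr tr'.
  move=> x xs; apply: usM; last by lra.
  have xk := between_dist xs; rewrite addrAC subrr add0r kn in xk.
  by apply: le_trans (ball_trans xk sr) _; lra.
have -> : quot us k s0 t0 = (us (s0 + k) t0 - us s0 t0) / k.
  by rewrite /quot; field; rewrite gt_eqF.
rewrite normrM normfV kn ler_pdivrMr //.
by have -> : 2 * (2 * M / e) / e = 4 * M / e ^+ 2 by field; rewrite gt_eqF.
Qed.

(** The limit is the supremum of the lower bounds q h - K |h|, each of which is at
most every upper bound q k + K |k|. *)
Lemma quot_cauchy (q : R -> R) (K d : R) : 0 < d -> 0 <= K ->
  (forall h k, h != 0 -> k != 0 -> `|h| < d -> `|k| < d ->
    `|q h - q k| <= K * (`|h| + `|k|)) ->
  exists l, forall h, h != 0 -> `|h| < d -> `|q h - l| <= K * `|h|.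
Proof.
move=> d0 K0 qc.
pose S := [set q h - K * `|h| | h in [set h | h != 0 /\ `|h| < d]].
have ub k : k != 0 -> `|k| < d -> ubound S (q k + K * `|k|).
  move=> k0 kd _ [h [h0 hd] <-].
  by have := qc _ _ h0 k0 hd kd; rewrite mulrDr ler_norml => /andP[_ ?]; lra.
have d2 : 0 < d / 2 by rewrite divr_gt0.
have d2d : `|d / 2| < d by rewrite gtr0_norm //; lra.
have d2n : d / 2 != 0 by rewrite gt_eqF.
have hs : has_sup S.
  split; first by exists (q (d / 2) - K * `|d / 2|), (d / 2).
  by exists (q (d / 2) + K * `|d / 2|); exact: ub.
exists (sup S) => h h0 hd; rewrite ler_norml.
have h1 : q h - K * `|h| <= sup S by apply: sup_upper_bound => //; exists h.
have h2 : sup S <= q h + K * `|h| by apply: ge_sup; [exact: hs.1|exact: ub].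
by apply/andP; split; lra.
Qed.

Lemma quot_lim (f : R -> R) (x l e : R) : is_derive x 1 f l -> 0 < e ->
  exists2 d, 0 < d & forall k, k != 0 -> `|k| < d ->
    `|k^-1 * f (x + k) + - k^-1 * f x - l| <= e.
Proof.
move=> /is_deriveP df /df[d d0 dP]; exists d => // k k0 /dP.
have -> : f (x + k) - f x - l * k = k * (k^-1 * f (x + k) + - k^-1 * f x - l).
  by field.
by rewrite normrM mulrC ler_pM2r // normr_gt0.
Qed.

Variables (s0 t0 r M : R) (p a a1 c a2 : R -> R -> R).
Hypothesis r0 : 0 < r.
Hypothesis hp : harmonic_on s0 t0 (9 * r) p a a1 c.
Hypothesis pM : forall s t, `|s - s0| < 9 * r -> `|t - t0| < 9 * r ->
  `|p s t| <= M.
Hypothesis dc : forall s t, `|s - s0| < 9 * r -> `|t - t0| < 9 * r ->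
  is_derive s 1 (c^~ t) (a2 s t).

Let L1 := 4 * M / r ^+ 2.
Let L2 := 4 * L1 / r ^+ 2.

(** Since a1 = p_ss, this makes a = p_s Lipschitz in s, which gives the rate of
convergence of the difference quotients in [quot_close]. *)
Let a1_bound s t : `|s - s0| <= 5 * r -> `|t - t0| <= 5 * r ->
  `|a1 s t| <= L1.
Proof.
(* a local copy of the section hypothesis, for [lra] *)
have r_gt0 := r0.
move=> sr tr.
apply: (@harmonic_second _ _ (9 * r - 5 * r) r M p a a1 c) => //; first by lra.
  by apply: harmonic_sub hp; lra.
move=> x y xs yt; apply: pM.
  by apply: le_lt_trans (ball_trans xs sr) _; lra.
by apply: le_lt_trans (ball_trans yt tr) _; lra.
Qed.

Let L10 : 0 <= L1.
Proof.
have r_gt0 := r0.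
by apply: le_trans (a1_bound (s := s0) (t := t0) _ _); rewrite ?subrr ?normr0 //; lra.
Qed.

Let quot_close s t h : h != 0 -> `|h| < r ->
  `|s - s0| <= 4 * r -> `|t - t0| <= 4 * r ->
  `|quot p h s t - a s t| <= L1 * `|h|.
Proof.
have r_gt0 := r0.
move=> h0 hr sr tr.
have near_s x : between s (s + h) x -> `|x - s| <= `|h| /\ `|x - s0| < 5 * r.
  move=> /between_dist; rewrite addrAC subrr add0r => xh; split=> //.
  by apply: le_lt_trans (ball_trans xh sr) _; lra.
have tr9 : `|t - t0| < 9 * r by lra.
have [|x xs E] := @MVT_between _ (p^~ t) (a^~ t) s (s + h).
  move=> x /near_s[_ xr]; have xr9 : `|x - s0| < 9 * r by lra.
  by have [] := hp xr9 tr9.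
have -> : quot p h s t = a x t.
  have -> : quot p h s t = (p (s + h) t - p s t) / h by rewrite /quot; field.
  by rewrite E; field.
have [xh _] := near_s _ xs.
apply: (@le_trans _ _ (L1 * `|x - s|)); last by rewrite ler_wpM2l.
apply: (@MVT_bound _ (a^~ t) (a1^~ t)) => y /(between_sub xs) /near_s[_ yr].
  have yr9 : `|y - s0| < 9 * r by lra.
  by have [] := hp yr9 tr9.
by apply: a1_bound; lra.
Qed.

(** Differences of two difference quotients of p, with their first derivative in t
and second derivative in s. *)
Let E h k : R -> R -> R := fun x y => 1 * quot p h x y + -1 * quot p k x y.
Let Et h k : R -> R -> R := fun x y => 1 * quot c h x y + -1 * quot c k x y.
Let Ess h k : R -> R -> R := fun x y => 1 * quot a1 h x y + -1 * quot a1 k x y.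

Let harmE h k : `|h| < r -> `|k| < r ->
  harmonic_on s0 t0 (8 * r) (E h k)
    (fun x y => 1 * quot a h x y + -1 * quot a k x y) (Ess h k) (Et h k).
Proof.
have r_gt0 := r0.
move=> hr kr; apply: harmonic_lin.
  by apply: harmonic_sub (harmonic_quot (k := h) hp); rewrite subrr normr0; lra.
by apply: harmonic_sub (harmonic_quot (k := k) hp); rewrite subrr normr0; lra.
Qed.

Let Ess_bound h k s t : h != 0 -> k != 0 -> `|h| < r -> `|k| < r ->
  `|s - s0| <= r -> `|t - t0| <= r -> `|Ess h k s t| <= L2 * (`|h| + `|k|).
Proof.
have r_gt0 := r0.
move=> h0 k0 hr kr sr tr.
have -> : L2 * (`|h| + `|k|) = 4 * (L1 * (`|h| + `|k|)) / r ^+ 2.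
  by rewrite /L2; field; rewrite gt_eqF.
apply: (@harmonic_second _ _ (8 * r - r) r (L1 * (`|h| + `|k|)) (E h k)
  (fun x y => 1 * quot a h x y + -1 * quot a k x y) (Ess h k) (Et h k)) => //.
- by lra.
- by apply: harmonic_sub (harmE hr kr); lra.
move=> x y xs yt.
have xr : `|x - s0| <= 4 * r by apply: le_trans (ball_trans xs sr) _; lra.
have yr : `|y - t0| <= 4 * r by apply: le_trans (ball_trans yt tr) _; lra.
have -> : E h k x y = (quot p h x y - a x y) - (quot p k x y - a x y).
  by rewrite /E; ring.
apply: le_trans (ler_normB _ _) _; rewrite mulrDr.
by apply: lerD; exact: quot_close.
Qed.

(** Along s, the quotients of a1 = p_ss are the second derivatives of the difference
quotients of p, and [Ess_bound] says that they form a Cauchy family.  Along t,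
the quotients of c = p_t in the direction s converge to a2 with increments in t
controlled uniformly ([incr]), while each of them has a derivative in t that is
the opposite of a quotient of a1. *)
Lemma primitive_smooth : exists l,
  is_derive s0 1 (a1^~ t0) l /\ is_derive t0 1 (a2 s0) (- l).
Proof.
have r_gt0 := r0.
have L20 : 0 <= L2 by apply: divr_ge0; [exact: mulr_ge0|exact: sqr_ge0].
have center (x : R) : `|x - x| <= r by rewrite subrr normr0 ltW.
have [l lP] : exists l, forall h, h != 0 -> `|h| < r ->
    `|quot a1 h s0 t0 - l| <= L2 * `|h|.
  apply: quot_cauchy => // h k h0 k0 hr kr.
  have -> : quot a1 h s0 t0 - quot a1 k s0 t0 = Ess h k s0 t0.
    by rewrite /Ess; ring.
  exact: Ess_bound.
exists l; split.
  apply/is_deriveP => e e0; have L21 : 0 < L2 + 1 by rewrite ltr_wpDl.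
  exists (Num.min r (e / (L2 + 1))) => [|h]; first by rewrite lt_min r0 divr_gt0.
  rewrite lt_min ltr_pdivlMr // => /andP[hr he].
  have [->|h0] := eqVneq h 0; first by rewrite addr0 subrr mulr0 subrr normr0 mulr0.
  have -> : a1 (s0 + h) t0 - a1 s0 t0 - l * h = (quot a1 h s0 t0 - l) * h.
    by rewrite /quot; field.
  rewrite normrM ler_wpM2r //; apply: le_trans (lP _ h0 hr) _.
  by apply: le_trans (ltW he); rewrite mulrC ler_wpM2l // lerDl.
have incr h t : h != 0 -> `|h| < r -> `|t - t0| <= r ->
    `|(quot c h s0 t - quot c h s0 t0) - (a2 s0 t - a2 s0 t0)|
      <= L2 * `|h| * `|t - t0|.
  move=> h0 hr tr; apply/ler_addgt0Pr => e e0.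
  have s00 : `|s0 - s0| < 9 * r by rewrite subrr normr0; lra.
  have t9 : `|t - t0| < 9 * r by lra.
  have t09 : `|t0 - t0| < 9 * r by rewrite subrr normr0; lra.
  have e3 : 0 < e / 3 by rewrite divr_gt0.
  have [d1 d10 k1] := quot_lim (dc s00 t9) e3.
  have [d2 d20 k2] := quot_lim (dc s00 t09) e3.
  (* the step k is chosen so small that its three contributions are at most e / 3 *)
  pose m := L2 * r + 1; have m0 : 0 < m by rewrite ltr_wpDl // mulr_ge0 // ltW.
  pose D := Num.min (Num.min d1 d2) (Num.min r (e / 3 / m)).
  have D0 : 0 < D by rewrite !lt_min d10 d20 r0 !divr_gt0.
  have kD : `|D / 2| < D by rewrite gtr0_norm ?divr_gt0 //; lra.
  have k0 : D / 2 != 0 by rewrite gt_eqF // divr_gt0.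
  move: (D / 2) k0 kD => k k0; rewrite !lt_min => /andP[/andP[kd1 kd2] /andP[kr ke]].
  have {k1}K1 := k1 _ k0 kd1; have {k2}K2 := k2 _ k0 kd2.
  have EtE : `|Et h k s0 t - Et h k s0 t0| <= L2 * (`|h| + `|k|) * `|t - t0|.
    have yr y : between t0 t y -> `|y - t0| <= r.
      by move=> /between_dist yt; apply: le_trans yt tr.
    apply: (@MVT_bound _ (Et h k s0) (fun y => - Ess h k s0 y)) => y /yr yr'.
      have s08 : `|s0 - s0| < 8 * r by rewrite subrr normr0; lra.
      have y8 : `|y - t0| < 8 * r by lra.
      by have [] := harmE hr kr s08 y8.
    by rewrite normrN; apply: Ess_bound.
  have ek : L2 * `|k| * `|t - t0| <= e / 3.
    apply: (@le_trans _ _ (L2 * `|k| * r)); first by apply: ler_wpM2l => //; exact: mulr_ge0.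
    rewrite ltr_pdivlMr // in ke; apply: le_trans (ltW ke).
    rewrite mulrAC mulrC ler_wpM2l // /m.
    by rewrite lerDl.
  have -> : (quot c h s0 t - quot c h s0 t0) - (a2 s0 t - a2 s0 t0) =
      (Et h k s0 t - Et h k s0 t0) + (quot c k s0 t - a2 s0 t)
      - (quot c k s0 t0 - a2 s0 t0) by rewrite /Et; ring.
  apply: le_trans (ler_normB _ _) _.
  apply: le_trans (lerD (ler_normD _ _) (lexx _)) _.
  have -> : L2 * `|h| * `|t - t0| + e =
      (L2 * `|h| * `|t - t0| + e / 3) + e / 3 + e / 3 by field.
  apply: lerD; last exact: K2.
  apply: lerD; last exact: K1.
  apply: le_trans EtE _; rewrite mulrDr mulrDl.
  by rewrite lerD2l.
apply/is_deriveP => e e0; have L21 : 0 < L2 + 1 by rewrite ltr_wpDl.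
have e4 : 0 < e / 4 by rewrite divr_gt0.
pose D := Num.min r (e / 4 / (L2 + 1)).
have D0 : 0 < D by rewrite !lt_min r0 !divr_gt0.
have kD : `|D / 2| < D by rewrite gtr0_norm ?divr_gt0 //; lra.
have k0 : D / 2 != 0 by rewrite gt_eqF // divr_gt0.
move: (D / 2) k0 kD => h h0; rewrite !lt_min => /andP[hr he].
have s00 : `|s0 - s0| < 9 * r - `|h| by rewrite subrr normr0; lra.
have t00 : `|t0 - t0| < 9 * r - `|h| by rewrite subrr normr0; lra.
have [_ _ _ _ /is_deriveP dq] := harmonic_quot (k := h) hp s00 t00.
have [d d0 dP] := dq _ e4.
exists (Num.min r d) => [|y]; first by rewrite lt_min r0.
rewrite lt_min => /andP[yr yd].
have := incr h (t0 + y) h0 hr; rewrite addrAC subrr add0r => /(_ (ltW yr)) I.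
have {}dP := dP _ yd.
have Lh : L2 * `|h| <= e / 4.
  rewrite ltr_pdivlMr // in he; apply: le_trans (ltW he).
  by rewrite mulrC ler_wpM2l // lerDl.
have lq := lP _ h0 hr.
have -> : a2 s0 (t0 + y) - a2 s0 t0 - - l * y =
  (quot c h s0 (t0 + y) - quot c h s0 t0 - - quot a1 h s0 t0 * y)
  - (quot c h s0 (t0 + y) - quot c h s0 t0 - (a2 s0 (t0 + y) - a2 s0 t0))
  - (quot a1 h s0 t0 - l) * y by ring.
apply: le_trans (ler_normB _ _) _.
apply: le_trans (lerD (ler_normB _ _) (lexx _)) _.
rewrite normrM.
have n1 : L2 * `|h| * `|y| <= e / 4 * `|y| by rewrite ler_wpM2r.
have n2 : `|quot a1 h s0 t0 - l| * `|y| <= e / 4 * `|y|.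
  by rewrite ler_wpM2r // (le_trans lq).
have n3 : 0 <= e / 4 * `|y| by rewrite mulr_ge0 // ltW.
have -> : e * `|y| = e / 4 * `|y| + e / 4 * `|y| + e / 4 * `|y| + e / 4 * `|y|.
  by field.
apply: (@le_trans _ _ (e / 4 * `|y| + e / 4 * `|y| + e / 4 * `|y|)).
  by apply: lerD n2; apply: lerD dP _; exact: le_trans I n1.
by rewrite lerDl.
Qed.

End Smoothness.

(** * Components of holomorphic stem functions *)

Section Conjugates.
Variable R : realType.
Implicit Types (s t x y r d e : R) (a b : R -> R -> R).

Lemma differential_atN a s t (us ut : R) :
  differential_at a s t us ut ->
  differential_at (fun x y => - a x y) s t (- us) (- ut).
Proof.
move=> da e /da[d d0 dP]; exists d => // x y xd yd.
rewrite -normrN.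
have -> : - (- a (s + x) (t + y) - - a s t - - us * x - - ut * y) =
  a (s + x) (t + y) - a s t - us * x - ut * y by ring.
exact: dP.
Qed.

(** The form a ds - b dt is closed; its primitive p has p_s = a and p_t = - b, hence
p_ss = a1 and p_tt = - a1, and - b has derivative a2 in s. *)
Lemma conjugate_smooth a b (a1 a2 : R -> R -> R) s0 t0 r : 0 < r ->
  (forall s t, `|s - s0| < r -> `|t - t0| < r ->
    differential_at a s t (a1 s t) (a2 s t) /\
    differential_at b s t (- a2 s t) (a1 s t)) ->
  exists l, is_derive s0 1 (a1^~ t0) l /\ is_derive t0 1 (a2 s0) (- l).
Proof.
move=> r0 dab; pose c x y := - b x y.
have dc s t : `|s - s0| < r -> `|t - t0| < r ->
    differential_at c s t (a2 s t) (- a1 s t).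
  move=> sr tr; rewrite -[a2 s t]opprK; apply: differential_atN.
  by have [] := dab _ _ sr tr.
have r3 : 0 < r / 3 by rewrite divr_gt0.
have [|p pP] := @closed_form_primitive _ a c a1 a2 (fun x y => - a1 x y) s0 t0
    (r / 3) r3.
  have -> : 3 * (r / 3) = r by field.
  by move=> s t sr tr; split; [have [] := dab _ _ sr tr|exact: dc].
have c0 (x : R) e : 0 < e -> `|x - x| < e by rewrite subrr normr0.
have [_ _ cp] := pP _ _ (c0 s0 _ r3) (c0 t0 _ r3).
have [d d0 dP] := cp 1 ltr01.
(* small enough for p to be bounded on the square of radius 9 e *)
pose e := Num.min d (r / 3) / 9.
have m0 : 0 < Num.min d (r / 3) by rewrite lt_min d0.
have e0 : 0 < e by rewrite divr_gt0.
have [e9d e9r] : 9 * e <= d /\ 9 * e <= r / 3.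
  have -> : 9 * e = Num.min d (r / 3) by rewrite /e; field.
  by rewrite !ge_min !lexx orbT.
have e9r' : 9 * e <= r by lra.
apply: (@primitive_smooth _ s0 t0 e (`|p s0 t0| + 1) p a a1 c a2 e0).
- move=> s t sr tr.
  have [ps pt cpst] := pP _ _ (lt_le_trans sr e9r) (lt_le_trans tr e9r).
  have [das _] := dab _ _ (lt_le_trans sr e9r') (lt_le_trans tr e9r').
  have dcs := dc _ _ (lt_le_trans sr e9r') (lt_le_trans tr e9r').
  split=> //; first exact: differential_at_s das.
  exact: differential_at_t dcs.
- move=> s t sr tr; have := dP (s - s0) (t - t0).
  rewrite !subrKC => /(_ (lt_le_trans sr e9d) (lt_le_trans tr e9d)) h.
  have := ler_normD (p s t - p s0 t0) (p s0 t0); rewrite subrK.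
  by move/le_trans; apply; rewrite addrC lerD2l.
- move=> s t sr tr.
  exact: differential_at_s (dc _ _ (lt_le_trans sr e9r') (lt_le_trans tr e9r')).
Qed.

End Conjugates.

Section HolomorphicStem.
Variables (R : realType) (m : nat).

Lemma differentiable_differential_at (f : R * R -> R) (s t : R) :
  differentiable f (s, t) ->
  differential_at (fun x y => f (x, y)) s t
    ('D_(1, 0) f (s, t)) ('D_(0, 1) f (s, t)).
Proof.
move=> df e e0; rewrite !deriveE //.
have /eqaddoP/(_ e e0) := diff_locally df.
rewrite -nbhs_nearE => /nbhs_ballP[d /= d0 dP].
exists d => // x y xd yd.
have := dP (x, y); rewrite /ball /=.
rewrite !fctE /=.
have -> : 'd f (s, t) (x, y) = 'd f (s, t) (1, 0) * x + 'd f (s, t) (0, 1) * y.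
  have -> : ((x, y) : R * R) = x *: (1, 0) + y *: (0, 1).
    by congr pair; rewrite /= /GRing.scale /=; ring.
  by rewrite linearD !linearZ /=; congr (_ + _); exact: mulrC.
have -> : (x, y) + (s, t) = (s + x, t + y) by congr pair; rewrite addrC.
rewrite !opprD !addrA => H; apply: le_trans (H _) _.
  by split; rewrite /ball /= sub0r normrN.
rewrite ler_pM2l // prod_normE /= ge_max.
by rewrite lerDl lerDr !normr_ge0.
Qed.

Lemma open_square (D : set R[i]) (s t : R) :
  open (D : set R[i]^o) -> D (s +i* t)%C ->
  exists2 d : R, 0 < d & forall x y : R, `|x - s| < d -> `|y - t| < d ->
    D (x +i* y)%C.
Proof.
move=> oD Dst; have : nbhs (s +i* t : R[i]^o)%C (D : set R[i]^o).
  exact: open_nbhs_nbhs.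
move=> /nbhs_ballP[[e1 e2] /=]; rewrite ltcE /= => /andP[/eqP e20 e10] eD.
exists (e1 / 2) => [|x y xs yt]; first by rewrite divr_gt0.
apply: eD; rewrite /ball /= normc_def ltcE /= e20 eqxx /=.
have e1E : e1 = Num.sqrt (e1 ^+ 2) by rewrite sqrtr_sqr gtr0_norm.
rewrite e1E ltr_sqrt ?exprn_gt0 //.
have sq z : `|z| < e1 / 2 -> z ^+ 2 < (e1 / 2) ^+ 2.
  by move=> ze; rewrite -(@real_normK _ z) ?num_real // ltr_sqr ?nnegrE // ltW // divr_gt0.
rewrite distrC in xs; rewrite distrC in yt.
have h1 := sq _ xs; have h2 := sq _ yt; have h3 := sqr_ge0 e1.
apply: lt_le_trans (ltrD h1 h2) _; rewrite !exprMn !exprVn.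
by lra.
Qed.

(** The curried form of [plane_coef], to differentiate in each variable. *)
Definition stem_coef (alpha : R[i] -> clifford R m) A (s t : R) : R :=
  coef A (alpha (s +i* t)%C).

Definition harmonic_partials (D : set R[i]) (u u1 u2 u11 : R -> R -> R) :=
  forall s t, D (s +i* t)%C ->
    [/\ is_derive s 1 (u^~ t) (u1 s t), is_derive t 1 (u s) (u2 s t),
        is_derive s 1 (u1^~ t) (u11 s t) & is_derive t 1 (u2 s) (- u11 s t)].

(** The Cauchy-Riemann equations are invariant under replacing (alpha, beta) by
(beta, - alpha), so [conjugate_smooth] applies to both components. *)
Lemma holomorphic_smooth (D : set R[i]) (alpha beta : R[i] -> clifford R m) A :
  open (D : set R[i]^o) -> holomorphic D alpha beta ->
  (exists a1 a2 a11, harmonic_partials D (stem_coef alpha A) a1 a2 a11) /\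
  (exists b1 b2 b11, harmonic_partials D (stem_coef beta A) b1 b2 b11).
Proof.
move=> oD hol.
pose a := stem_coef alpha A; pose b := stem_coef beta A.
pose a1 (s t : R) := 'D_(1, 0) (plane_coef alpha A) (s, t).
pose a2 (s t : R) := 'D_(0, 1) (plane_coef alpha A) (s, t).
have dab s t : D (s +i* t)%C -> differential_at a s t (a1 s t) (a2 s t) /\
    differential_at b s t (- a2 s t) (a1 s t).
  move=> Dst; have [da db cr1 cr2] := hol s t Dst A.
  split; first exact: (differentiable_differential_at da).
  rewrite /a1 /a2 cr1 cr2 opprK; exact: (differentiable_differential_at db).
have near s t : D (s +i* t)%C -> exists2 d : R, 0 < d &
    forall x y : R, `|x - s| < d -> `|y - t| < d ->
    differential_at a x y (a1 x y) (a2 x y) /\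
    differential_at b x y (- a2 x y) (a1 x y).
  move=> /(open_square oD)[d d0 dD]; exists d => // x y xs yt.
  exact/dab/dD.
have /choice[la laP] (st : R * R) : exists l, D (st.1 +i* st.2)%C ->
    is_derive st.1 1 (a1^~ st.2) l /\ is_derive st.2 1 (a2 st.1) (- l).
  case: st => s t; have [Dst|nD] := pselect (D (s +i* t)%C); last by exists 0.
  have [d d0 /(conjugate_smooth d0)[l lP]] := near _ _ Dst.
  by exists l.
have /choice[lb lbP] (st : R * R) : exists l, D (st.1 +i* st.2)%C ->
    is_derive st.1 1 (fun s => - a2 s st.2) l /\ is_derive st.2 1 (a1 st.1) (- l).
  case: st => s t; have [Dst|nD] := pselect (D (s +i* t)%C); last by exists 0.
  have [d d0 dP] := near _ _ Dst.
  have [|l lP] := @conjugate_smooth _ b (fun x y => - a x y)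
      (fun x y => - a2 x y) a1 s t d d0.
    move=> x y xs yt; have [dax dbx] := dP _ _ xs yt.
    by split=> //; exact: differential_atN.
  by exists l.
split.
  exists a1, a2, (fun x y => la (x, y)) => s t Dst.
  have [das _] := dab _ _ Dst; have [l1 l2] := laP (s, t) Dst.
  by split=> //; [exact: differential_at_s das|exact: differential_at_t das].
exists (fun x y => - a2 x y), a1, (fun x y => lb (x, y)) => s t Dst.
have [_ dbs] := dab _ _ Dst; have [l1 l2] := lbP (s, t) Dst.
by split=> //; [exact: differential_at_s dbs|exact: differential_at_t dbs].
Qed.

End HolomorphicStem.

(** * Functions of the radius along a line *)

Section Lines.
Variable R : realType.

Lemma is_derive_line (V : normedModType R) (g : V -> R) (x v : V) (l : R) :
  is_derive (0 : R) 1 (fun h => g (h *: v + x)) l -> is_derive x v g l.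
Proof.
have -> : is_derive (0 : R) 1 (fun h => g (h *: v + x)) l =
    is_derive x v g l; last by [].
apply: propext.
have E : (fun h : R => h^-1 *: (((fun h => g (h *: v + x)) \o shift 0) (h *: (1 : R))
    - g (0 *: v + x))) = (fun h : R => h^-1 *: ((g \o shift x) (h *: v) - g x)).
  apply/funext => h /=; congr (_ *: (g _ - g _)).
    by rewrite addr0 /GRing.scale /= mulr1.
  by rewrite scale0r add0r.
split=> -[h1 h2]; split.
- by rewrite /derivable -E.
- by rewrite -h2 /derive E.
- by rewrite /derivable E.
- by rewrite -h2 /derive E.
Qed.

Lemma is_derive_along (V : normedModType R) (g : V -> R) (x v : V)
    (phi : R -> R) (y0 d l : R) : 0 < d ->
  (forall h, `|h| < d -> g (h *: v + x) = phi (h + y0)) ->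
  is_derive y0 1 phi l -> is_derive x v g l.
Proof.
move=> d0 gphi dphi; apply: is_derive_line.
apply: (@is_derive_near _ (fun h => phi (h + y0)) _ _ _ d d0).
  by move=> h; rewrite subr0 => /gphi.
by apply: is_derive_translate; rewrite add0r.
Qed.

(** Both derivatives in the direction v are those of the restriction phi of g to a
line, so the second partial derivatives below are computed in one variable. *)
Lemma second_derive_along (V : normedModType R) (g : V -> R) (x v : V)
    (phi phi1 : R -> R) (y0 d l : R) : 0 < d ->
  (forall h, `|h| < d -> g (h *: v + x) = phi (h + y0)) ->
  (forall h, `|h| < d -> is_derive (h + y0) 1 phi (phi1 (h + y0))) ->
  is_derive y0 1 phi1 l ->
  is_derive x v g (phi1 y0) /\ is_derive x v ('D_v g) l.
Proof.
move=> d0 gphi dphi dphi1; split.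
  apply: (is_derive_along d0 gphi).
  by have := dphi 0; rewrite normr0 add0r; exact.
apply: (is_derive_along d0 _ dphi1) => h hd.
apply: derive_val; apply: (@is_derive_along V g (h *: v + x) v phi (h + y0) (d - `|h|)).
- by rewrite subr_gt0.
- move=> k kd; have kh : `|k + h| < d.
    by rewrite (le_lt_trans (ler_normD _ _)) // -ltrBrDr.
  by rewrite !addrA -scalerDl (gphi _ kh).
- exact: dphi.
Qed.

Lemma is_derive_radius (c y : R) : 0 < c + y ^+ 2 ->
  is_derive y 1 (fun y => Num.sqrt (c + y ^+ 2)) (y / Num.sqrt (c + y ^+ 2)).
Proof.
move=> cy; have s0 : Num.sqrt (c + y ^+ 2) != 0 by rewrite gt_eqF // sqrtr_gt0.
have -> : y / Num.sqrt (c + y ^+ 2) = (2 * Num.sqrt (c + y ^+ 2))^-1 * (2 * y).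
  by field.
apply: (@is_derive1_comp _ Num.sqrt (fun y => c + y ^+ 2)).
  exact: is_derive1_sqrt.
by apply: (@is_derive_quad _ _ _ _ 1) => h; ring.
Qed.

Lemma is_derive_mul (f g : R -> R) (x a b : R) :
  is_derive x 1 f a -> is_derive x 1 g b ->
  is_derive x 1 (fun y => f y * g y) (a * g x + f x * b).
Proof.
move=> df dg.
have -> : a * g x + f x * b = f x *: b + g x *: a.
  by rewrite /GRing.scale /= addrC (mulrC a).
exact: is_deriveM.
Qed.

Lemma is_derive_affine (p q y : R) : is_derive y 1 (fun y => p + q * y) q.
Proof. by apply: (@is_derive_quad _ _ _ _ 0) => h; ring. Qed.

Section Radial.
Variables (B B2 B22 : R -> R) (p q c : R).
Let rho y : R := Num.sqrt (c + y ^+ 2).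

(** The derivative of (p + q y) B(sqrt(c + y ^ 2)). *)
Definition radial_derive (y : R) : R :=
  q * B (rho y) + (p + q * y) * (B2 (rho y) * (y / rho y)).

Lemma is_derive_radial y : 0 < c + y ^+ 2 ->
  is_derive (rho y) 1 B (B2 (rho y)) ->
  is_derive y 1 (fun y => (p + q * y) * B (rho y)) (radial_derive y).
Proof.
move=> cy dB; apply: is_derive_mul; first exact: is_derive_affine.
by apply: (@is_derive1_comp _ B rho) => //; exact: is_derive_radius.
Qed.

Lemma is_derive_radial_derive y : 0 < c + y ^+ 2 ->
  is_derive (rho y) 1 B (B2 (rho y)) -> is_derive (rho y) 1 B2 (B22 (rho y)) ->
  is_derive y 1 radial_derive
    (2 * q * (B2 (rho y) * (y / rho y)) + (p + q * y) *
      (B22 (rho y) * (y / rho y) ^+ 2 +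
       B2 (rho y) * ((rho y)^-1 - y ^+ 2 / rho y ^+ 3))).
Proof.
move=> cy dB dB2.
have r0 : rho y != 0 by rewrite gt_eqF // sqrtr_gt0.
have drho := is_derive_radius cy.
have dB' : is_derive y 1 (fun y => B (rho y)) (B2 (rho y) * (y / rho y)).
  exact: (@is_derive1_comp _ B rho).
have dB2' : is_derive y 1 (fun y => B2 (rho y)) (B22 (rho y) * (y / rho y)).
  exact: (@is_derive1_comp _ B2 rho).
have did : is_derive y 1 (fun y : R => y) 1 by exact: is_derive_id.
have dV : is_derive y 1 (fun y => (rho y)^-1) (- rho y ^- 2 *: (y / rho y)).
  exact: is_deriveV.
have dq := is_derive_mul (is_derive_cst q y 1) dB'.
have d1 := is_derive_mul did dV.
have d2 := is_derive_mul dB2' d1.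
have d3 := is_derive_mul (is_derive_affine p q y) d2.
have := is_deriveD dq d3.
congr is_derive; rewrite /GRing.scale /= mul0r add0r.
by field.
Qed.

End Radial.
End Lines.

(** * Laplacian of an affine factor times a function of the radius *)

Section RadialProfile.
Variables (R : realType) (m : nat).
Implicit Types (x y : 'rV[R]_(1 + m)) (j : 'I_(1 + m)) (k : 'I_m).

Definition radius x : R := vnorm (rsubmx x).

Lemma radius_ge0 x : 0 <= radius x.
Proof. exact: sqrtr_ge0. Qed.

Lemma sqr_radius x : radius x ^+ 2 = \sum_(k < m) x 0 (rshift 1 k) ^+ 2.
Proof.
rewrite sqr_sqrtr; last by apply: sumr_ge0 => k _; exact: sqr_ge0.
by apply: eq_bigr => k _; rewrite mxE.
Qed.

Lemma coord_line x j i h :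
  (h *: delta_mx 0 j + x) 0 i = h * (i == j)%:R + x 0 i.
Proof. by rewrite !mxE eqxx. Qed.

Lemma index_cases j : j = ord0 \/ exists k, j = rshift 1 k.
Proof.
case: (split_ordP j) => [i ->|k ->]; last by right; exists k.
by left; apply: val_inj; rewrite /= ord1.
Qed.

Lemma rshift_neq0 k : (rshift 1 k == ord0 :> 'I_(1 + m)) = false.
Proof. by apply/eqP => /(congr1 val). Qed.

Lemma radius_line0 x h : radius (h *: delta_mx 0 ord0 + x) = radius x.
Proof.
rewrite /radius /vnorm; congr Num.sqrt; apply: eq_bigr => k _.
by rewrite [in LHS]mxE coord_line rshift_neq0 mulr0 add0r mxE.
Qed.

(** The sum of the squares of the coordinates of the vector part other than the k-th,
which is constant along the k-th coordinate line. *)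
Definition cross_radius x k : R := radius x ^+ 2 - x 0 (rshift 1 k) ^+ 2.

Lemma radius_line x k h : radius (h *: delta_mx 0 (rshift 1 k) + x) =
  Num.sqrt (cross_radius x k + (h + x 0 (rshift 1 k)) ^+ 2).
Proof.
rewrite -[LHS]ger0_norm ?radius_ge0 // -sqrtr_sqr; congr Num.sqrt.
rewrite /cross_radius !sqr_radius (bigD1 k) //= coord_line eqxx mulr1.
rewrite [in RHS](bigD1 k) //= [RHS]addrC; congr (_ + _).
rewrite addrAC subrr add0r; apply: eq_bigr => i ik.
by rewrite coord_line (inj_eq (@rshift_inj _ _)) (negPf ik) mulr0 add0r.
Qed.

Lemma is_derive_dist (f : R -> R) (x l e : R) : is_derive x 1 f l -> 0 < e ->
  exists2 d, 0 < d & forall h, `|h| < d -> `|f (h + x) - f x| < e.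
Proof.
move=> /is_derive_continuous /cvgrPdist_lt/(_ e) + e0 => /(_ e0).
move=> /nbhs_ballP[d /= d0 dP]; exists d => // h hd.
by rewrite distrC; apply: dP; rewrite /ball /= distrC addrK.
Qed.

Variable D : set R[i].
Hypothesis oD : open (D : set R[i]^o).
Variables B B1 B2 B11 B22 : R -> R -> R.
Hypothesis dB : forall s t, D (s +i* t)%C -> 0 < t ->
  [/\ is_derive s 1 (B^~ t) (B1 s t), is_derive t 1 (B s) (B2 s t),
      is_derive s 1 (B1^~ t) (B11 s t) & is_derive t 1 (B2 s) (B22 s t)].
Variables (kappa : 'rV[R]_(1 + m) -> R) (q : 'I_(1 + m) -> R).
Hypothesis kappa_affine : forall x j h,
  kappa (h *: delta_mx 0 j + x) = q j * h + kappa x.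
Hypothesis q0 : q ord0 = 0.
Variable g : 'rV[R]_(1 + m) -> R.
Hypothesis gE : forall y, D (slice_point y) -> 0 < radius y ->
  g y = kappa y * B (y 0 ord0) (radius y).

Variable x : 'rV[R]_(1 + m).
Hypothesis Dx : D (slice_point x).
Hypothesis rx : 0 < radius x.
Let s0 := x 0 ord0.
Let r := radius x.

Let slice_square : exists2 d : R, 0 < d & forall s t : R,
  `|s - s0| < d -> `|t - r| < d -> D (s +i* t)%C /\ 0 < t.
Proof.
have [d d0 dD] := open_square oD Dx.
exists (Num.min d r) => [|s t]; first by rewrite lt_min d0.
rewrite !lt_min => /andP[sd _] /andP[td tr]; split; first exact: dD.
by move: tr; rewrite ltr_norml => /andP[? _]; lra.
Qed.

Lemma derive_axis :
  is_derive x (delta_mx 0 ord0) g (kappa x * B1 s0 r) /\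
  is_derive x (delta_mx 0 ord0) (partial ord0 g) (kappa x * B11 s0 r).
Proof.
have [d d0 dD] := slice_square.
have sh h : `|h| < d -> D ((h + s0) +i* r)%C /\ 0 < r.
  by move=> hd; apply: dD; rewrite ?addrK // subrr normr0.
apply: (@second_derive_along _ _ g x (delta_mx 0 ord0)
  (fun s => kappa x * B s r) (fun s => kappa x * B1 s r) s0 d) => //.
- move=> h /sh[Dh r0].
  have s0E : (h *: delta_mx 0 ord0 + x) 0 ord0 = h + s0.
    by rewrite coord_line eqxx mulr1.
  rewrite gE ?radius_line0 // ?s0E.
    by rewrite kappa_affine q0 mul0r add0r.
  by rewrite /slice_point -/(radius _) radius_line0 s0E.
- move=> h /sh[Dh r0]; have [d1 _ _ _] := dB Dh r0.
  exact: is_deriveZ.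
- by have [_ _ d11 _] := dB Dx rx; exact: is_deriveZ.
Qed.

Lemma derive_radial k : let xk := x 0 (rshift 1 k) in
  is_derive x (delta_mx 0 (rshift 1 k)) g
    (q (rshift 1 k) * B s0 r + kappa x * (B2 s0 r * (xk / r))) /\
  is_derive x (delta_mx 0 (rshift 1 k)) (partial (rshift 1 k) g)
    (2 * q (rshift 1 k) * (B2 s0 r * (xk / r)) + kappa x *
      (B22 s0 r * (xk / r) ^+ 2 + B2 s0 r * (r^-1 - xk ^+ 2 / r ^+ 3))).
Proof.
move=> xk; pose c := cross_radius x k; pose qk := q (rshift 1 k).
have cxk : c + xk ^+ 2 = r ^+ 2 by rewrite /c /cross_radius subrK.
have rho : Num.sqrt (c + xk ^+ 2) = r by rewrite cxk sqrtr_sqr ger0_norm ?radius_ge0.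
have cpos : 0 < c + xk ^+ 2 by rewrite cxk exprn_gt0.
have [d d0 dD] := slice_square.
have [d1 d10 near_r] := is_derive_dist (is_derive_radius cpos) d0.
rewrite rho in near_r.
have near h : `|h| < d1 -> D (s0 +i* Num.sqrt (c + (h + xk) ^+ 2))%C /\
    0 < Num.sqrt (c + (h + xk) ^+ 2).
  by move=> hd; apply: dD; [rewrite subrr normr0|exact: near_r].
pose p := kappa x - qk * xk.
have pE : p + qk * xk = kappa x by rewrite /p subrK.
have <- : radial_derive (B s0) (B2 s0) p qk c xk =
    qk * B s0 r + kappa x * (B2 s0 r * (xk / r)).
  by rewrite /radial_derive rho pE.
apply: (@second_derive_along _ _ g x (delta_mx 0 (rshift 1 k))
  (fun t => (p + qk * t) * B s0 (Num.sqrt (c + t ^+ 2)))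
  (radial_derive (B s0) (B2 s0) p qk c) xk d1 _ d10).
- move=> h /near[Dh r0].
  have s0E : (h *: delta_mx 0 (rshift 1 k) + x) 0 ord0 = s0.
    by rewrite coord_line eq_sym rshift_neq0 mulr0 add0r.
  rewrite gE ?radius_line ?s0E //.
    by rewrite kappa_affine /p -/qk; congr (_ * _); rewrite -/xk; ring.
  by rewrite /slice_point -/(radius _) radius_line s0E.
- move=> h /near[Dh r0]; have [_ dBt _ _] := dB Dh r0.
  by apply: is_derive_radial => //; rewrite -sqrtr_gt0.
- have [_ dBt _ dBtt] := dB Dx rx; rewrite -pE -rho.
  by apply: is_derive_radial_derive; rewrite ?rho.
Qed.

Lemma profile_second_partials j :
  derivable g x (delta_mx 0 j) /\ derivable (partial j g) x (delta_mx 0 j).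
Proof.
case: (index_cases j) => [->|[k ->]].
  by have [[? _] [? _]] := derive_axis.
by have [[? _] [? _]] := derive_radial k.
Qed.

Lemma profile_partial k : partial (rshift 1 k) g x =
  q (rshift 1 k) * B s0 r + kappa x * (B2 s0 r * (x 0 (rshift 1 k) / r)).
Proof. by have [[_ ?] _] := derive_radial k. Qed.

(** The k-th second derivative is [derive_radial]; summing over k, the squares of the
coordinates add up to the squared radius, and the two terms in B2 / r that remain
are the usual first order term of the radial Laplacian and twice the scalar
product of the gradients of kappa and B. *)
Lemma profile_laplacian : laplacian g x =
  kappa x * (B11 s0 r + B22 s0 r + (m%:R - 1) * (B2 s0 r / r)) +
  2 * (B2 s0 r / r) * \sum_(k < m) q (rshift 1 k) * x 0 (rshift 1 k).
Proof.
rewrite /laplacian big_split_ord big_ord1 /=.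
have -> : lshift m (@ord0 0) = ord0 by exact: val_inj.
have -> : partial ord0 (partial ord0 g) x = kappa x * B11 s0 r.
  by have [_ [_ E]] := derive_axis.
rewrite (eq_bigr (fun k => 2 * (B2 s0 r / r) * (q (rshift 1 k) * x 0 (rshift 1 k))
  + (kappa x * (B22 s0 r / r ^+ 2 - B2 s0 r / r ^+ 3) * x 0 (rshift 1 k) ^+ 2
  + kappa x * (B2 s0 r / r)))); last first.
  move=> k _; have [_ [_ E]] := derive_radial k.
  rewrite [LHS]E.
  by field; rewrite gt_eqF.
rewrite !big_split /= -!mulr_sumr -sqr_radius sumr_const card_ord -/r.
rewrite -mulr_natr.
by field; rewrite gt_eqF.
Qed.

End RadialProfile.

(** * Uniqueness of the components and the theorem *)

Section Components.
Variables (R : realType) (m : nat).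
Implicit Types (D : set R[i]) (x : 'rV[R]_(1 + m)) (v : 'rV[R]_m).
Implicit Types (alpha beta : R[i] -> clifford R m).

Lemma vnormZ (b : R) v : vnorm (b *: v) = `|b| * vnorm v.
Proof.
rewrite /vnorm -sqrtr_sqr -sqrtrM ?sqr_ge0 //; congr Num.sqrt.
by rewrite mulr_sumr; apply: eq_bigr => j _; rewrite mxE exprMn.
Qed.

(** Exchanging the two summation indices pairs each product of distinct generators
with its opposite. *)
Lemma clifford_vector_sqr v :
  clifford_vector v * clifford_vector v = - (vnorm v ^+ 2) *: 1.
Proof.
set S := LHS.
have SE : S = \sum_(i < m) \sum_(j < m) (v 0 i * v 0 j) *: (gen R i * gen R j).
  rewrite /S /clifford_vector mulr_suml; apply: eq_bigr => i _.
  rewrite mulr_sumr; apply: eq_bigr => j _.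
  by rewrite -scalerAl -scalerAr scalerA.
(* symmetrised, only the diagonal terms remain *)
have SS : S + S = (- (vnorm v ^+ 2) *: 1) + (- (vnorm v ^+ 2) *: 1).
  rewrite {1}SE exchange_big SE -big_split /=.
  rewrite sqr_sqrtr; last by apply: sumr_ge0 => j _; exact: sqr_ge0.
  rewrite -scalerDl -opprD -big_split -sumrN scaler_suml /=.
  apply: eq_bigr => i _; rewrite -big_split /= (bigD1 i) //= big1 ?addr0.
    by rewrite gen_sqr -expr2 -scalerDl scalerN scaleNr.
  move=> j ji; rewrite (mulrC (v 0 j)) -scalerDr.
  by rewrite (gen_anticomm R ji) addNr scaler0.
apply: Defs.coefP => A; have := congr1 (coef A) SS; rewrite !Defs.coefD => E.
by lra.
Qed.

Lemma paravector0 (a : R) v : paravector a v 0 ord0 = a.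
Proof.
have -> : (ord0 : 'I_(1 + m)) = lshift m ord0 by exact: val_inj.
by rewrite row_mxEl mxE eqxx.
Qed.

Lemma slice_paravector (a : R) v : slice_point (paravector a v) = (a +i* vnorm v)%C.
Proof. by rewrite /slice_point paravector0 row_mxKr. Qed.

Lemma completion_slice D x : conj_symmetric D ->
  (axially_symmetric_completion D `\` @real_axis R m) x ->
  D (slice_point x) /\ 0 < radius x.
Proof.
move=> cD [[a [b [w [Dab w1 ->]]]] nx]; rewrite slice_paravector /radius row_mxKr.
rewrite vnormZ w1 mulr1; split.
  have [b0|/ltW b0] := leP 0 b; first by rewrite ger0_norm.
  by rewrite ler0_norm //; exact: (cD _ Dab).
by rewrite normr_gt0; apply: contra_notN nx => /eqP->; rewrite /real_axis /= row_mxKr scale0r.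
Qed.

(** Both pairs give the value of f at x and at the point with opposite vector part.
Half the sum of the values is alpha, and half the difference is omega beta, where
omega is invertible since its square is -1. *)
Lemma stem_unique D alpha beta alpha' beta' f x :
  induces D alpha beta f -> induces D alpha' beta' f ->
  D (slice_point x) -> 0 < radius x ->
  alpha (slice_point x) = alpha' (slice_point x) /\
  beta (slice_point x) = beta' (slice_point x).
Proof.
move=> fab fab' Dx rx; pose r := radius x.
pose w := r^-1 *: rsubmx x.
have r0 : 0 < r by [].
have w1 : vnorm w = 1.
  rewrite vnormZ ger0_norm; last by rewrite invr_ge0 ltW.
  by rewrite -/(radius x) mulVf // gt_eqF.
(* e = 1 and e = -1 give the two points of the sphere in the direction of x *)
have sphere (e : R) : `|e| = 1 -> f (paravector (x 0 ord0) (r *: (e *: w))) =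
      alpha (slice_point x) + (e *: clifford_vector w) * beta (slice_point x) /\
    f (paravector (x 0 ord0) (r *: (e *: w))) =
      alpha' (slice_point x) + (e *: clifford_vector w) * beta' (slice_point x).
  move=> e1.
  have ew1 : vnorm (e *: w) = 1 by rewrite vnormZ e1 w1 mulr1.
  have rw : vnorm (r *: (e *: w)) = r by rewrite vnormZ ew1 mulr1 gtr0_norm.
  have inU : axially_symmetric_completion D (paravector (x 0 ord0) (r *: (e *: w))).
    by exists (x 0 ord0), r, (e *: w).
  have om : omega (paravector (x 0 ord0) (r *: (e *: w))) = e *: clifford_vector w.
    rewrite /omega row_mxKr rw (scalerA r^-1) mulVf ?gt_eqF // scale1r.
    rewrite /clifford_vector.
    by rewrite scaler_sumr; apply: eq_bigr => j _; rewrite mxE scalerA.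
  by rewrite {1}(fab _ inU) (fab' _ inU) om slice_paravector rw.
have [p1 p2] := sphere 1 (normr1 _); have [n1 n2] := sphere (-1) (normrN1 _).
rewrite p1 scale1r in p2; rewrite n1 scaleN1r !mulNr in n2.
set W := clifford_vector w in p2 n2.
move: p2 n2; set a := alpha _; set a' := alpha' _; set b := beta _; set b' := beta' _.
move=> p n.
have aE : a = a'.
  apply: Defs.coefP => A; have := congr1 (coef A) p; have := congr1 (coef A) n.
  by rewrite !Defs.coefD !Defs.coefN; lra.
split=> //; have WE : W * b = W * b' by move: p; rewrite aE => /addrI.
have := congr1 (fun y => W * y) WE; rewrite !mulrA clifford_vector_sqr w1 expr1n.
by rewrite !scaleN1r !mulN1r => /oppr_inj.
Qed.

End Components.

Theorem theorem3p8 (R : realType) (m : nat) (D : set R[i])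
    (f : 'rV[R]_(1 + m) -> clifford R m) (alpha beta : R[i] -> clifford R m) :
  (0 < m)%N ->
  open (D : set R[i]^o) -> conj_symmetric D ->
  slice_regular D f ->
  stem_function D alpha beta -> induces D alpha beta f ->
  let U := axially_symmetric_completion D `\` @real_axis R m in
  [/\ hyperbolic_harmonic U (fun x => alpha (slice_point x)),
      (forall j : 'I_(1 + m), (1 <= j <= m.-1)%N ->
         hyperbolic_harmonic U
           (fun x => omega_coord j x *: beta (slice_point x)))
    & hyperbolic_eigenfunction U (1 - m%:R)
        (fun x => omega_coord ord_max x *: beta (slice_point x))].
Proof.
move=> m0 oD cD [al [be [_ hol fab']]] _ fab U.
(* the last coordinate belongs to the vector part since m > 0 *)
have [kmax kmaxE] : exists k, ord_max = rshift 1 k :> 'I_(1 + m).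
  case: (index_cases (ord_max : 'I_(1 + m))) => // /(congr1 val) /= mE.
  by rewrite mE in m0.
have uniq (x : 'rV[R]_(1 + m)) : D (slice_point x) -> 0 < radius x ->
    alpha (slice_point x) = al (slice_point x) /\
    beta (slice_point x) = be (slice_point x).
  by move=> Dx rx; exact: (stem_unique fab fab' Dx rx).
have alphaH (x : 'rV[R]_(1 + m)) A : D (slice_point x) -> 0 < radius x ->
   let g y := coef A (alpha (slice_point y)) in
   (forall j, derivable g x (delta_mx 0 j) /\
     derivable (partial j g) x (delta_mx 0 j)) /\
   x 0 ord_max ^+ 2 * laplacian g x
     - (m%:R - 1) * x 0 ord_max * partial ord_max g x = 0.
  move=> Dx rx g.
  have [[a1 [a2 [a11 dA]]] _] := holomorphic_smooth A oD hol.
  have dB s t : D (s +i* t)%C -> 0 < t ->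
      [/\ is_derive s 1 ((stem_coef al A)^~ t) (a1 s t),
        is_derive t 1 (stem_coef al A s) (a2 s t),
        is_derive s 1 (a1^~ t) (a11 s t) & is_derive t 1 (a2 s) (- a11 s t)].
    by move=> Dst _; exact: dA.
  have kA (y : 'rV[R]_(1 + m)) (j : 'I_(1 + m)) (h : R) : (fun=> 1 : R) (h *: delta_mx 0 j + y) =
    (fun=> 0 : R) j * h + (fun=> 1 : R) y by rewrite mul0r add0r.
  have gE (y : 'rV[R]_(1 + m)) : D (slice_point y) -> 0 < radius y ->
      g y = 1 * stem_coef al A (y 0 ord0) (radius y).
    by move=> Dy ry; rewrite mul1r /g (uniq _ Dy ry).1.
  split; first exact: (profile_second_partials oD dB kA erefl gE Dx rx).
  rewrite (profile_laplacian oD dB kA erefl gE Dx rx) kmaxE.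
  rewrite (profile_partial oD dB kA gE Dx rx) big1; last by move=> k _; rewrite mul0r.
  by field; rewrite gt_eqF.
have betaH (x : 'rV[R]_(1 + m)) A (i : 'I_m) : D (slice_point x) -> 0 < radius x ->
   let g y := coef A (omega_coord (rshift 1 i) y *: beta (slice_point y)) in
   (forall j, derivable g x (delta_mx 0 j) /\
     derivable (partial j g) x (delta_mx 0 j)) /\
   x 0 ord_max ^+ 2 * laplacian g x
     - (m%:R - 1) * x 0 ord_max * partial ord_max g x =
   (i == kmax)%:R * (1 - m%:R) * g x.
  move=> Dx rx g.
  have [_ [b1 [b2 [b11 dA]]]] := holomorphic_smooth A oD hol.
  pose b := stem_coef be A.
  (* omega_j beta = x_j * (beta / |x|), with beta / |x| a function of x_0 and |x| *)
  pose B s t := b s t / t.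
  pose B2 s t := b2 s t / t - b s t / t ^+ 2.
  pose B22 s t := - b11 s t / t - 2 * b2 s t / t ^+ 2 + 2 * b s t / t ^+ 3.
  have dB s t : D (s +i* t)%C -> 0 < t ->
      [/\ is_derive s 1 (B^~ t) (b1 s t / t), is_derive t 1 (B s) (B2 s t),
        is_derive s 1 ((fun s t => b1 s t / t)^~ t) (b11 s t / t)
        & is_derive t 1 (B2 s) (B22 s t)].
    move=> Dst t0; have [d1 d2 d3 d4] := dA _ _ Dst.
    have tn0 : t != 0 by rewrite gt_eqF.
    have did : is_derive t 1 (fun y : R => y) 1 by exact: is_derive_id.
    have dV : is_derive t 1 (fun y => y^-1) (- t ^- 2 *: 1) by exact: is_deriveV.
    have dVV : is_derive t 1 (fun y => (y ^+ 2)^-1) (- (t ^+ 2) ^- 2 *: (2 * t)).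
      apply: is_deriveV; first by rewrite expf_neq0.
      by apply: (@is_derive_quad _ _ _ _ 1) => h; ring.
    split.
    - have := is_derive_mul d1 (is_derive_cst (t^-1) s 1).
      by rewrite mulr0 addr0.
    - have := is_derive_mul d2 dV; congr is_derive.
      rewrite /B2 /b /GRing.scale /=; by field.
    - have := is_derive_mul d3 (is_derive_cst (t^-1) s 1).
      by rewrite mulr0 addr0.
    - have := is_deriveB (is_derive_mul d4 dV) (is_derive_mul d2 dVV).
      congr is_derive.
      rewrite /B22 /b /GRing.scale /=; by field.
  pose kap (y : 'rV[R]_(1 + m)) := y 0 (rshift 1 i).
  pose q (j : 'I_(1 + m)) : R := (rshift 1 i == j)%:R.
  have kA (y : 'rV[R]_(1 + m)) (j : 'I_(1 + m)) (h : R) : kap (h *: delta_mx 0 j + y) = q j * h + kap y.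
    by rewrite /kap coord_line mulrC.
  have q0 : q ord0 = 0 by rewrite /q rshift_neq0.
  have gE (y : 'rV[R]_(1 + m)) : D (slice_point y) -> 0 < radius y ->
      g y = kap y * B (y 0 ord0) (radius y).
    move=> Dy ry; rewrite /g Defs.coefZ (uniq _ Dy ry).2 /omega_coord /B /kap.
    by rewrite -/(radius y) mulrAC mulrA.
  split; first exact: (profile_second_partials oD dB kA q0 gE Dx rx).
  rewrite (profile_laplacian oD dB kA q0 gE Dx rx) kmaxE.
  rewrite (profile_partial oD dB kA gE Dx rx) gE //.
  rewrite (bigD1 i) //= big1 ?addr0; last first.
    move=> k ki; rewrite /q (inj_eq (@rshift_inj _ _)) eq_sym (negPf ki).
    by rewrite mul0r.
  rewrite /q eqxx mul1r (inj_eq (@rshift_inj _ _)) /B /B2 /B22.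
  have rn0 : radius x != 0 by rewrite gt_eqF.
  by rewrite /kap; have [->|_] := eqVneq i kmax; rewrite /=; field.
have Uslice (x : 'rV[R]_(1 + m)) : U x -> D (slice_point x) /\ 0 < radius x.
  exact: completion_slice.
split.
- move=> x /Uslice[Dx rx]; split; first by move=> A; exact: (alphaH x A Dx rx).1.
  apply: Defs.coefP => A; rewrite Defs.coef0 /coef ffunE.
  exact: (alphaH x A Dx rx).2.
- move=> j /andP[j1 jm] x /Uslice[Dx rx].
  have [j0|[k jk]] := index_cases j; first by rewrite j0 in j1.
  have kk : (k == kmax) = false.
    apply/eqP => kE; move: jm; rewrite jk kE -kmaxE /=.
    by case: (m) m0 => // n _; rewrite ltnn.
  rewrite jk; split; first by move=> A; exact: (betaH x A k Dx rx).1.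
  apply: Defs.coefP => A; rewrite Defs.coef0 /coef ffunE.
  by have := (betaH x A k Dx rx).2; rewrite kk !mul0r.
- move=> x /Uslice[Dx rx].
  rewrite kmaxE; split; first by move=> A; exact: (betaH x A kmax Dx rx).1.
  apply: Defs.coefP => A; rewrite Defs.coefZ [LHS]/coef ffunE.
  have := (betaH x A kmax Dx rx).2; rewrite eqxx mul1r; exact.
Qed.
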